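(* Assume that $0<\beta<1$ and let $p=p(N)\in(0,1]$ be such that $p^3N^2\to\infty$ as $N\to\infty$. Then $L_N$, considered as a random element of $\mathcal M(\mathbb R)$, converges in probability to $\mathfrak N_{0,1/(1-\beta)}$. That is to say, for every $\varepsilon>0$, $$\lim_{N\to\infty}\mathbb P\left[d_L\left(L_N,\mathfrak N_{0,1/(1-\beta)}\right)>\varepsilon\right]=0.$$
   Context: For each $N\in\mathbb N$ let $p=p(N)\in(0,1]$ and let $(\varepsilon_{i,j})_{i,j=1}^N$ be independent random variables on a probability space with probability measure $\mathbb P$, with $\mathbb P[\varepsilon_{i,j}=1]=p$ and $\mathbb P[\varepsilon_{i,j}=0]=1-p$ (indicators of the directed edges, loops allowed, of a directed Erdős–Rényi random graph on $\{1,\dots,N\}$). The Hamiltonian is, for $\sigma=(\sigma_1,\dots,\sigma_N)\in\{-1,+1\}^N$, $$H(\sigma)=H_N(\sigma)=-\frac1{2Np}\sum_{i,j=1}^N\varepsilon_{i,j}\sigma_i\sigma_j,$$ and the partition function is $Z_N(\beta)=\sum_{\sigma\in\{-1,+1\}^N}e^{-\beta H(\sigma)}$. $\mathcal M(\mathbb R)$ is the space of probability measures on $\mathbb R$ with the topology of weak convergence, metrized by the Lévy metric $$d_L(\mu_1,\mu_2)=\inf\{\varepsilon>0:\ \mu_1(-\infty,t-\varepsilon]-\varepsilon\le\mu_2(-\infty,t]\le\mu_1(-\infty,t+\varepsilon]+\varepsilon \text{ for all } t\in\mathbb R\}.$$ $L_N$ is the random probability measure $$L_N=\frac1{Z_N(\beta)}\sum_{\sigma\in\{-1,+1\}^N}e^{-\beta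 H(\sigma)}\,\delta_{\frac1{\sqrt N}\sum_{i=1}^N\sigma_i},$$ where $\delta_x$ is the Dirac measure at $x$; it is random through $(\varepsilon_{i,j})$. $\mathfrak N_{0,s^2}\in\mathcal M(\mathbb R)$ denotes the normal distribution with mean $0$ and variance $s^2$. *)

(* Defs.v *)
From HB Require Import structures.
From mathcomp Require Import all_boot all_order all_algebra.
From mathcomp Require Import all_classical all_reals all_analysis.

Set Implicit Arguments.
Unset Strict Implicit.
Unset Printing Implicit Defensive.

Import Order.TTheory GRing.Theory Num.Theory.
Import numFieldNormedType.Exports.

Local Open Scope classical_set_scope.
Local Open Scope ring_scope.

Definition mutually_independent d (Omega : measurableType d) (R : realType)
    (P : probability Omega R) (I : finType) (X : I -> {RV P >-> R}) : Prop :=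
  forall (J : {set I}) (B : I -> set R), (forall i, measurable (B i)) ->
    P (\bigcap_(i in [set` J]) (X i @^-1` B i)) =
    (\prod_(i in J) P (X i @^-1` B i))%E.

(* A configuration in {-1,+1}^N is encoded as a finite function to bool, with
   true standing for +1 and false for -1. *)
Definition spin (R : realType) (N : nat) (sigma : {ffun 'I_N -> bool})
    (i : 'I_N) : R :=
  if sigma i then 1 else -1.

(* In the next definitions, e i j is the realized value of the edge variable
   attached to the directed edge (i, j). *)
Definition hamiltonian (R : realType) (N : nat) (p : R)
    (e : 'I_N -> 'I_N -> R) (sigma : {ffun 'I_N -> bool}) : R :=
  - (1 / (2 * N%:R * p)) *
    \sum_(i < N) \sum_(j < N) e i j * spin R sigma i * spin R sigma j.

Definition partition_function (R : realType) (beta : R) (N : nat) (p : R)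
    (e : 'I_N -> 'I_N -> R) : R :=
  \sum_(sigma : {ffun 'I_N -> bool}) expR (- beta * hamiltonian p e sigma).

Definition magnetization (R : realType) (N : nat)
    (sigma : {ffun 'I_N -> bool}) : R :=
  1 / Num.sqrt N%:R * \sum_(i < N) spin R sigma i.

Section gibbs_law.
Context (R : realType) (beta : R) (N : nat) (p : R) (e : 'I_N -> 'I_N -> R).

Definition gibbs_law (A : set (measurableTypeR R)) : \bar R :=
  ((1 / partition_function beta p e)%:E *
   \sum_(sigma : {ffun 'I_N -> bool})
     (expR (- beta * hamiltonian p e sigma))%:E *
     \d_(magnetization R sigma : measurableTypeR R) A)%E.

Lemma partition_function_gt0 : 0 < partition_function beta p e.
Proof.
rewrite /partition_function (bigD1 [ffun=> true])//=.
by rewrite ltr_pwDl ?expR_gt0// sumr_ge0// => s _; exact: expR_ge0.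
Qed.

Let gibbs_law0 : gibbs_law set0 = 0%E.
Proof. by rewrite /gibbs_law big1 ?mule0// => s _; rewrite measure0 mule0. Qed.

Let gibbs_law_ge0 A : (0 <= gibbs_law A)%E.
Proof.
apply: mule_ge0.
  by rewrite lee_fin divr_ge0// ltW// partition_function_gt0.
by apply: sume_ge0 => s _; rewrite mule_ge0// lee_fin expR_ge0.
Qed.

Let gibbs_law_sigma_additive : semi_sigma_additive gibbs_law.
Proof.
pose s_ k := nth [ffun=> true] (enum {ffun 'I_N -> bool}) k.
pose w_ k := NngNum (expR_ge0 (- beta * hamiltonian p e (s_ k))).
have Z0 : 0 <= 1 / partition_function beta p e.
  by rewrite divr_ge0// ltW// partition_function_gt0.
pose mu : {measure set _ -> \bar R} := mscale (NngNum Z0)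
  (msum (fun k => mscale (w_ k) (\d_(magnetization R (s_ k) : measurableTypeR R)))
        #|{: {ffun 'I_N -> bool}}|).
suff -> : gibbs_law = mu by exact: measure_semi_sigma_additive.
apply/funext => A; rewrite /gibbs_law /mu/= /mscale/= /msum/=; congr (_ * _)%E.
rewrite (eq_bigl (mem {: {ffun 'I_N -> bool}}))// big_enum_val/=.
by apply: eq_bigr => k _; rewrite /mscale/= (enum_val_nth [ffun=> true]).
Qed.

HB.instance Definition _ := isMeasure.Build _ _ _ gibbs_law
  gibbs_law0 gibbs_law_ge0 gibbs_law_sigma_additive.

Let gibbs_law_setT : gibbs_law [set: measurableTypeR R] = 1%E.
Proof.
rewrite /gibbs_law; under eq_bigr do rewrite diracT mule1.
by rewrite sumEFin -EFinM mul1r mulVf// gt_eqF// partition_function_gt0.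
Qed.

HB.instance Definition _ :=
  @Measure_isProbability.Build _ _ _ gibbs_law gibbs_law_setT.

End gibbs_law.

Definition levy_dist (R : realType)
    (mu1 mu2 : probability (measurableTypeR R) R) : R :=
  inf [set eps : R | 0 < eps /\ forall t : R,
    (mu1 `]-oo, (t - eps)%R]%classic - eps%:E <= mu2 `]-oo, t]%classic)%E /\
    (mu2 `]-oo, t]%classic <= mu1 `]-oo, (t + eps)%R]%classic + eps%:E)%E].

(* Main.v *)
Require Import Defs.
From HB Require Import structures.
From mathcomp Require Import all_boot all_order all_algebra.
From mathcomp Require Import all_classical all_reals all_analysis.
From mathcomp Require Import measurable_realfun normal_distribution random_variable.
From mathcomp Require Import ring lra zify.
Import Order.TTheory GRing.Theory Num.Theory.
Import numFieldNormedType.Exports.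
Local Open Scope classical_set_scope.
Local Open Scope ring_scope.

(* The edge variables are averaged out exactly: for signs s, the log-moment
   generating function of a Bernoulli(p) edge at g * s is affine in s, so that
   E[exp(- beta H)] is, up to a factor that does not depend on the
   configuration, the Curie-Weiss weight exp(b X^2 / 2) of the normalized
   magnetization X, with b -> beta.  In the same way, for two configurations
   with magnetizations X and Y, E[exp(- beta H(s) - beta H(t))] is proportional
   to exp(b' (X^2 + Y^2) / 2 + m W^2 / 2), where W is the magnetization of the
   product s * t, m = O(1 / (N p)), and the ratio of the two prefactors exceeds
   1 by O(1 / (p^3 N^2)) at most; this is the only use of p^3 N^2 -> oo beyond
   N p -> oo.  Convexity of exp removes the W-term, hence restricted partition
   functions concentrate in L^2 around Curie-Weiss averages.  These averages
   converge by dominated convergence, applied to step functions built from a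
   local comparison of binomial coefficients with the Gaussian density that
   needs no Stirling formula: only ratios of Curie-Weiss sums matter. *)

(** * Binomial coefficients against a Gaussian profile *)

Section BinomialProfile.
Context {R : realType}.
Implicit Types (N k : nat) (u : R).

(** After division by [expR u] the claim becomes [0 <= f u]; [f] vanishes at 0 and its derivative
    [x * (expR x - expR (- x))] is nonnegative for [x >= 0]. *)
Lemma subr_mul_expR2_le u : 0 <= u -> (1 - u) * expR (2 * u) <= 1 + u.
Proof.
move=> u0.
pose f (x : R) := (1 + x) * expR (- x) - (1 - x) * expR x.
have df (x : R) : is_derive x 1 f (x * (expR x - expR (- x))).
  apply: is_derive_eq; rewrite /GRing.scale/=; ring.
have f'E (x : R) : derive1 f x = x * (expR x - expR (- x)).
  by rewrite derive1E; exact: derive_val.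
have fle : f 0 <= f u.
  apply: (@ger0_derive1_ndecr _ f 0 u) => //.
  - move=> x; rewrite in_itv/= => /andP[x0 _]; rewrite f'E.
    by rewrite mulr_ge0 ?(ltW x0)// subr_ge0 ler_expR; lra.
  - by apply: derivable_within_continuous => x _; exact: ex_derive.
have : 0 <= f u by apply: le_trans fle; rewrite /f oppr0 expR0; lra.
rewrite /f subr_ge0 => h.
have -> : expR (2 * u) = expR u * expR u by rewrite -expRD; congr expR; ring.
rewrite mulrA (le_trans (ler_wpM2r (expR_ge0 _) h))//.
by rewrite -mulrA -expRD addNr expR0 mulr1.
Qed.

(** Up to [u = 1 / 2] the tangent bound [1 + 2 * u <= expR (2 * u)] suffices; beyond it the left
    side is nonpositive. One step away from the centre thus costs only a factor [1 - O(u ^+ 2)]. *)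
Lemma subr_mul_expR2_ge u : 0 <= u < 1 ->
  (1 - 4 * u ^+ 2) * (1 + u) <= (1 - u) * expR (2 * u).
Proof.
move=> /andP[u0 u1].
have u1' : 0 < 1 - u by lra.
have [h|h] := leP u (1 / 2); last first.
  rewrite (@le_trans _ _ 0)//; last by rewrite mulr_ge0 ?expR_ge0//; lra.
  by rewrite mulr_le0_ge0//; nra.
have : 1 + 2 * u <= expR (2 * u) by exact: expR_ge1Dx.
nra.
Qed.

Definition gauss_profile N k : R :=
  expR (- (2 * k%:R - N%:R) ^+ 2 / (2 * N.+1%:R)).

Definition bin_to_gauss N k : R := 'C(N, k)%:R / gauss_profile N k.

(* Half the discrete slope of the Gaussian exponent: [gauss_profile] is chosen
   so that its consecutive ratio is exactly [expR (- (2 * bin_tilt N k))], while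
   that of the binomials is [(1 - bin_tilt N k) / (1 + bin_tilt N k)]. *)
Definition bin_tilt N k : R := (2 * k%:R + 1 - N%:R) / N.+1%:R.

Lemma bin_to_gauss_gt0 N k : (k <= N)%N -> 0 < bin_to_gauss N k.
Proof. by move=> kN; rewrite divr_gt0 ?expR_gt0// ltr0n bin_gt0. Qed.

Lemma bin_to_gaussS N k : (k < N)%N ->
  bin_to_gauss N k.+1 * (1 + bin_tilt N k) =
  bin_to_gauss N k * ((1 - bin_tilt N k) * expR (2 * bin_tilt N k)).
Proof.
move=> kN; rewrite /bin_to_gauss /gauss_profile -!expRN.
have N0 : N.+1%:R != 0 :> R by rewrite pnatr_eq0.
set A := expR (- _ ); set B := expR (- _).
have -> : A = B * expR (- (2 * bin_tilt N k)) ^+ 0 * expR (2 * bin_tilt N k).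
  rewrite expr0 mulr1 -expRD; congr expR; rewrite /bin_tilt -!natr1.
  by rewrite -natr1 in N0; field.
rewrite expr0 mulr1.
(* The factors [1 + bin_tilt N k] and [1 - bin_tilt N k] equal [2 (k + 1) / (N + 1)] and
   [2 (N - k) / (N + 1)], so this is the recursion [(k + 1) C(N, k + 1) = (N - k) C(N, k)]. *)
have c : 'C(N, k.+1)%:R * (1 + bin_tilt N k) = 'C(N, k)%:R * (1 - bin_tilt N k).
  have := mul_bin_left N k => /(congr1 (fun n => n%:R : R)).
  rewrite !natrM natrB 1?ltnW// => e.
  rewrite /bin_tilt; apply: (@mulfI _ (N.+1%:R / 2)); first by rewrite mulf_neq0// invr_eq0; lra.
  transitivity (k.+1%:R * 'C(N, k.+1)%:R : R); first by rewrite -!natr1; rewrite -natr1 in N0; field.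
  by rewrite e -!natr1; rewrite -natr1 in N0; field.
by rewrite mulrAC c; ring.
Qed.

Lemma bin_tilt_itv N k : (uphalf N <= k < N)%N -> 0 <= bin_tilt N k < 1.
Proof.
move=> /andP[ck kN].
have h1 : (N <= 2 * k)%N by rewrite mul2n -leq_uphalf_double.
rewrite /bin_tilt divr_ge0 ?ltr_pdivrMr ?mul1r//=; last first.
  have : N%:R <= (2 * k)%:R :> R by rewrite ler_nat.
  by rewrite natrM; lra.
have : k.+1%:R <= N%:R :> R by rewrite ler_nat.
by rewrite -!natr1; lra.
Qed.

(** Induction outwards from the centre: each step multiplies by a factor between [1 - 4 u ^+ 2] and
    1. The tilt [u] grows with [k], so its square at [k] bounds every term of the accumulated
    loss. *)
Lemma bin_to_gauss_bounds N k : (uphalf N <= k <= N)%N ->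
  (1 - 4 * (k - uphalf N)%:R * ((2 * k%:R + 1 - N%:R) / N.+1%:R) ^+ 2) *
    bin_to_gauss N (uphalf N) <= bin_to_gauss N k <= bin_to_gauss N (uphalf N).
Proof.
elim: k => [|k IH].
  rewrite leqn0 andbT => /eqP ->; rewrite subnn mulr0 mul0r subr0 mul1r.
  by rewrite lexx.
rewrite leq_eqVlt => /andP[/orP[/eqP <- _|]].
  by rewrite subnn mulr0 mul0r subr0 mul1r lexx.
rewrite ltnS => ck kN.
have /andP[lo up] : _ := IH (introT andP (conj ck (ltnW kN))).
have /andP[u0 u1] := bin_tilt_itv N k (introT andP (conj ck kN)).
have rS := bin_to_gaussS N k kN.
have r0 := bin_to_gauss_gt0 N k (ltnW kN).
have c0 : 0 < bin_to_gauss N (uphalf N).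
  by rewrite bin_to_gauss_gt0// (leq_trans ck (ltnW kN)).
have h1 := subr_mul_expR2_le _ u0.
have h2 := subr_mul_expR2_ge (bin_tilt N k) (introT andP (conj u0 u1)).
have u10 : 0 < 1 + bin_tilt N k by lra.
have a1 : bin_to_gauss N k.+1 <= bin_to_gauss N k.
  by rewrite -(ler_pM2r u10) rS ler_wpM2l// ltW.
have a2 : (1 - 4 * bin_tilt N k ^+ 2) * bin_to_gauss N k <= bin_to_gauss N k.+1.
  by rewrite -(ler_pM2r u10) rS mulrAC mulrC ler_wpM2l// ltW.
apply/andP; split; last exact: le_trans up.
apply: le_trans a2.
have uv : bin_tilt N k <= (2 * k.+1%:R + 1 - N%:R) / N.+1%:R.
  by rewrite /bin_tilt ler_pM2r ?invr_gt0// -natr1; lra.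
rewrite -/(bin_tilt N k) in lo.
set u := bin_tilt N k in u0 u1 uv lo *.
set v := _ / _ in uv *.
have uv2 : u ^+ 2 <= v ^+ 2 by rewrite ler_pXn2r// nnegrE; lra.
set q := bin_to_gauss N k in up lo r0 *.
set c := bin_to_gauss N _ in up lo c0 *.
rewrite subSn//.
have -> : (k - uphalf N).+1%:R = (k - uphalf N)%:R + 1 :> R by rewrite natr1.
set m : R := (k - uphalf N)%:R in lo *.
have m0 : 0 <= m by rewrite ler0n.
have e1 : 0 <= (m + 1) * c * (v ^+ 2 - u ^+ 2).
  by apply: mulr_ge0; [apply: mulr_ge0; [lra|exact: ltW]|rewrite subr_ge0].
have e2 : 0 <= u ^+ 2 * (c - q) by rewrite mulr_ge0 ?exprn_ge0 ?subr_ge0.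
rewrite -subr_ge0.
have -> : (1 - 4 * u ^+ 2) * q - (1 - 4 * (m + 1) * v ^+ 2) * c =
  (q - (1 - 4 * m * u ^+ 2) * c) + 4 * (u ^+ 2 * (c - q))
  + 4 * ((m + 1) * c * (v ^+ 2 - u ^+ 2)) by ring.
by apply: addr_ge0; [apply: addr_ge0; [rewrite subr_ge0|lra]|lra].
Qed.

Lemma bin_to_gauss_sym N k : (k <= N)%N -> bin_to_gauss N (N - k) = bin_to_gauss N k.
Proof.
move=> kN; rewrite /bin_to_gauss /gauss_profile bin_sub// natrB//.
have -> : 2 * (N%:R - k%:R) - N%:R = - (2 * k%:R - N%:R) :> R by ring.
by rewrite sqrrN.
Qed.

(** Reflection reduces to the upper half, where the number of steps from the centre is at most
    [2 k - N]; times the squared tilt this gives the cube. For [2 k - N] of order [sqrt N] the error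
    is of order [1 / sqrt N]. *)
Lemma bin_to_gauss_estimate N k : (k <= N)%N ->
  1 - 4 * (`|2 * k%:R - N%:R| + 1) ^+ 3 / N.+1%:R ^+ 2
    <= bin_to_gauss N k / bin_to_gauss N (uphalf N) <= 1.
Proof.
wlog ck : k / (uphalf N <= k)%N.
  move=> wl kN; have [/wl|kc] := leqP (uphalf N) k; first exact.
  have := wl (N - k)%N; rewrite bin_to_gauss_sym//.
  have -> : `|2 * (N - k)%:R - N%:R| = `|2 * k%:R - N%:R| :> R.
    by rewrite natrB// -normrN; congr `|_|; ring.
  by apply; lia.
move=> kN.
have c0 : 0 < bin_to_gauss N (uphalf N).
  by rewrite bin_to_gauss_gt0// (leq_trans ck kN).
have /andP[lo up] := bin_to_gauss_bounds N k (introT andP (conj ck kN)).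
rewrite ler_pdivlMr// ler_pdivrMr// mul1r up andbT; apply: le_trans lo.
rewrite ler_wpM2r ?(ltW c0)// lerD2l lerN2.
have h1 : N%:R <= 2 * k%:R :> R by rewrite -natrM ler_nat mul2n -leq_uphalf_double.
rewrite ger0_norm; last lra.
have -> : 2 * k%:R + 1 - N%:R = 2 * k%:R - N%:R + 1 :> R by ring.
set y : R := 2 * k%:R - N%:R.
rewrite expr_div_n mulrA ler_pM2r ?invr_gt0 ?exprn_gt0// -mulrA.
rewrite ler_wpM2l// [leRHS]exprS ler_wpM2r ?exprn_ge0//; first by rewrite /y; lra.
have : (k - uphalf N)%:R <= (2 * k - N)%:R :> R by rewrite ler_nat; lia.
rewrite (@natrB _ (2 * k)); last by lia.
by rewrite natrM /y; lra.
Qed.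

End BinomialProfile.

(** * Curie-Weiss averages *)

Section CurieWeissRiemannSum.
Context {R : realType}.
Implicit Types (N k : nat) (b x : R) (A : set R).

Definition grid N k : R := (2 * k%:R - N%:R) / Num.sqrt N%:R.

Definition cell N k : set R := `[grid N k, grid N k + 2 / Num.sqrt N%:R[.

(* Dividing by the value of [bin_to_gauss] at the centre replaces the
   normalization by [2 ^+ N] and makes Stirling's formula unnecessary. *)
Definition cw_weight b A N k : R :=
  'C(N, k)%:R / bin_to_gauss N (uphalf N) * expR (b * grid N k ^+ 2 / 2)
  * \1_A (grid N k).

Definition cw_sum b A N : R :=
  \sum_(k < N.+1) cw_weight b A N k * (2 / Num.sqrt N%:R).

(** The step function whose Lebesgue integral is [cw_sum]; it brings the sums over [k] within reach
    of dominated convergence. *)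
Definition cw_step b A N x : R :=
  \sum_(k < N.+1) cw_weight b A N k * \1_(cell N k) x.

Lemma sqrt_natr_gt0 N : (0 < N)%N -> 0 < Num.sqrt N%:R :> R.
Proof. by rewrite sqrtr_gt0 ltr0n. Qed.

Lemma cellP N k x : (0 < N)%N ->
  cell N k x <-> k%:R <= (x * Num.sqrt N%:R + N%:R) / 2 < k.+1%:R.
Proof.
move=> /sqrt_natr_gt0 N0; rewrite /cell/= in_itv/= /grid -mulrDl.
rewrite ler_pdivrMr// ltr_pdivlMr// ler_pdivlMr// ltr_pdivrMr// -natr1.
by split=> /andP[? ?]; apply/andP; split; lra.
Qed.

Lemma cell_inj N k j x : (0 < N)%N -> cell N k x -> cell N j x -> k = j.
Proof.
move=> N0 /(cellP _ _ _ N0)/andP[k1 k2] /(cellP _ _ _ N0)/andP[j1 j2].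
have := le_lt_trans k1 j2; have := le_lt_trans j1 k2.
by rewrite !ltr_nat; lia.
Qed.

Lemma cw_stepE b A N k x : (0 < N)%N -> (k <= N)%N -> cell N k x ->
  cw_step b A N x = cw_weight b A N k.
Proof.
move=> N0 kN xk; rewrite /cw_step (bigD1 (Ordinal (kN : (k < N.+1)%N)))//=.
rewrite indicE mem_set// mulr1 big1 ?addr0// => j /eqP jk.
rewrite indicE memNset ?mulr0// => xj; apply: jk; apply/val_inj => /=.
exact: cell_inj xj xk.
Qed.

Lemma cw_step0 b A N x : ~ (exists2 k, (k <= N)%N & cell N k x) ->
  cw_step b A N x = 0.
Proof.
move=> nx; rewrite /cw_step big1// => j _; rewrite indicE memNset ?mulr0// => xj.
by apply: nx; exists (val j) => //; rewrite -ltnS ltn_ord.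
Qed.

Lemma measurable_cell N k : measurable (cell N k).
Proof. exact: measurable_itv. Qed.

Lemma cw_weight_ge0 b A N k : 0 <= cw_weight b A N k.
Proof.
rewrite /cw_weight !mulr_ge0 ?expR_ge0 ?invr_ge0//.
by rewrite ltW// bin_to_gauss_gt0//; lia.
Qed.

Lemma lebesgue_measure_cell N k : (0 < N)%N ->
  lebesgue_measure (cell N k) = (2 / Num.sqrt N%:R)%:E :> \bar R.
Proof.
move=> N0.
rewrite /cell lebesgue_measure_itv/= lte_fin ltrDl divr_gt0 ?sqrt_natr_gt0//.
by rewrite -EFinB addrAC subrr add0r.
Qed.

Lemma integral_cw_step b A N : (0 < N)%N ->
  (\int[lebesgue_measure]_x (cw_step b A N x)%:E = (cw_sum b A N)%:E)%E.
Proof.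
move=> N0; rewrite /cw_step /cw_sum -sumEFin.
under eq_integral do rewrite -sumEFin.
rewrite ge0_integral_sum//; last 2 first.
- move=> k; apply/measurable_EFinP; apply: measurable_funM => //.
  by apply: measurable_indic; exact: measurable_cell.
- by move=> k x _; rewrite lee_fin mulr_ge0// cw_weight_ge0.
apply: eq_bigr => k _.
under eq_integral do rewrite EFinM.
rewrite ge0_integralZl_EFin//; last 2 first.
- by apply/measurable_EFinP; apply: measurable_indic; exact: measurable_cell.
- exact: cw_weight_ge0.
rewrite integral_indic//; last exact: measurable_cell.
by rewrite setIT [in RHS]EFinM -(lebesgue_measure_cell _ k N0).
Qed.

Lemma measurable_cw_step b A N : measurable_fun setT (cw_step b A N).
Proof.
apply: measurable_sum => k; apply: measurable_funM => //.
by apply: measurable_indic; exact: measurable_cell.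
Qed.

(** [gauss_profile] is the exponential of [- (N / (N + 1)) * grid ^+ 2 / 2], so merging the
    exponents leaves the coefficient [b - N / (N + 1)], which tends to [b - 1]. *)
Lemma cw_weightE b A N k : (0 < N)%N -> (k <= N)%N ->
  cw_weight b A N k = bin_to_gauss N k / bin_to_gauss N (uphalf N) *
   expR ((b - N%:R / N.+1%:R) * grid N k ^+ 2 / 2) * \1_A (grid N k).
Proof.
move=> N0 kN; rewrite /cw_weight; congr (_ * _).
have -> : (b - N%:R / N.+1%:R) * grid N k ^+ 2 / 2 =
   - (2 * k%:R - N%:R) ^+ 2 / (2 * N.+1%:R) + b * grid N k ^+ 2 / 2.
  rewrite /grid expr_div_n sqr_sqrtr//.
  have n0 : N%:R != 0 :> R by rewrite pnatr_eq0 -lt0n.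
  have n1 : N.+1%:R != 0 :> R by rewrite pnatr_eq0.
  by move: (N.+1%:R) n1 => m n1; field; rewrite n0.
rewrite expRD -/(gauss_profile N k) [bin_to_gauss N k]/bin_to_gauss.
have p0 : gauss_profile N k != 0 :> R by apply/lt0r_neq0/expR_gt0.
have c0 : bin_to_gauss N (uphalf N) != 0 :> R.
  by apply/lt0r_neq0/bin_to_gauss_gt0; lia.
by field; rewrite ?p0 ?c0.
Qed.

End CurieWeissRiemannSum.

(** * Pointwise limit and Gaussian domination of the step functions *)

Section CurieWeissPointwiseLimit.
Context {R : realType}.
Implicit Types (N k : nat) (b x a : R) (A : set R).

Lemma cvg_invr_natr : N%:R^-1 @[N --> \oo] --> (0 : R).
Proof. by rewrite -(cvg_shiftS (fun n => n%:R^-1 : R)); exact: cvg_harmonic. Qed.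

Lemma cvg_invr_sqrt_natr : (Num.sqrt N%:R)^-1 @[N --> \oo] --> (0 : R).
Proof.
have -> : (fun N => (Num.sqrt N%:R)^-1) = (fun N => Num.sqrt (N%:R^-1) : R).
  by apply/funext => N; rewrite sqrtrV.
rewrite -[X in _ --> X](@sqrtr0 R).
by apply: continuous_cvg; [exact: sqrt_continuous|exact: cvg_invr_natr].
Qed.

Lemma cvg_natr_ratio : N%:R / N.+1%:R @[N --> \oo] --> (1 : R).
Proof.
have h : (1 - N.+1%:R^-1 : R) @[N --> \oo] --> (1 - 0 : R).
  by apply: cvgB; [exact: cvg_cst|exact: cvg_harmonic].
rewrite subr0 in h; apply: cvg_trans h; apply: near_eq_cvg; near=> N.
have n0 : N.+1%:R != 0 :> R by rewrite pnatr_eq0.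
by apply: (mulIf n0); rewrite mulrBl mulVf// divfK// -natr1; ring.
Unshelve. all: by end_near. Qed.

Lemma nearest_grid_cell N x : (0 < N)%N -> `|x| <= Num.sqrt N%:R ->
  let k := Num.truncn ((x * Num.sqrt N%:R + N%:R) / 2) in
  (k <= N)%N /\ cell N k x.
Proof.
move=> N0; rewrite ler_norml => /andP[x1 x2] k.
have s0 : 0 < Num.sqrt N%:R :> R by exact: sqrt_natr_gt0.
have yE : (x * Num.sqrt N%:R + N%:R) / 2 = (x + Num.sqrt N%:R) * Num.sqrt N%:R / 2.
  by rewrite [in RHS]mulrDl -expr2 sqr_sqrtr.
have y0 : 0 <= (x * Num.sqrt N%:R + N%:R) / 2.
  by rewrite yE divr_ge0// mulr_ge0 ?(ltW s0)//; lra.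
split; last by apply/(cellP _ _ _ N0); exact: truncn_itv.
rewrite -(ler_nat R); apply: le_trans (_ : _ <= (x * Num.sqrt N%:R + N%:R) / 2) _.
  by rewrite truncn_le.
have : (Num.sqrt N%:R - x) * Num.sqrt N%:R >= 0.
  by rewrite mulr_ge0 ?(ltW s0)//; lra.
by rewrite mulrBl -expr2 sqr_sqrtr// ler_pdivrMr//; lra.
Qed.

(** The cell containing [x] has its left end [z N] within [2 / sqrt N] of [x], and the ratio [rho]
    of [bin_to_gauss] to its central value tends to 1 because [x] is fixed. *)
Lemma cw_step_cvg (b_ : nat -> R) b A x : b_ @ \oo --> b ->
  {for x, continuous (\1_A : R -> R)} ->
  cw_step (b_ N) A N x @[N --> \oo] --> expR ((b - 1) * x ^+ 2 / 2) * \1_A x.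
Proof.
move=> bb cA.
pose k N := Num.truncn ((x * Num.sqrt N%:R + N%:R) / 2).
pose z N := grid N (k N) : R.
have near_x : \forall N \near \oo, (0 < N)%N /\ `|x| <= Num.sqrt N%:R :> R.
  near=> N; split; first by near: N; exists 1%N.
  rewrite -[leLHS]ger0_norm// -sqrtr_sqr ler_wsqrtr//.
  by near: N; exact: nbhs_infty_ger.
have z_x : z N @[N --> \oo] --> x.
  apply: (@squeeze_cvgr _ _ _ _ (fun N => x - 2 * (Num.sqrt N%:R)^-1) (cst x)).
  - near=> N.
    have [N0 /(nearest_grid_cell _ _ N0)[_]] : (0 < N)%N /\ `|x| <= Num.sqrt N%:R :> R.
      by near: N.
    rewrite -/(k N) /cell/= in_itv/= => /andP[? ?].
    by rewrite /z; apply/andP; split => //; lra.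
  - rewrite -[X in _ --> X]subr0 -[X in _ --> _ - X](mulr0 2).
    by apply: cvgB; [exact: cvg_cst|apply: cvgMr; exact: cvg_invr_sqrt_natr].
  - exact: cvg_cst.
pose rho N : R := bin_to_gauss N (k N) / bin_to_gauss N (uphalf N).
have rho1 : rho N @[N --> \oo] --> (1 : R).
  (* From [|z N| <= |x| + 2] and [sqrt N >= 1] one gets [|2 k - N| + 1 <= (|x| + 3) sqrt N]; the
     cube divided by [(N + 1) ^+ 2] is at most [(|x| + 3) ^+ 3 / sqrt N]. *)
  apply: (@squeeze_cvgr _ _ _ _
    (fun N => 1 - 4 * (`|x| + 3) ^+ 3 * (Num.sqrt N%:R)^-1) (cst 1)).
  - near=> N.
    have [N0 xN] : (0 < N)%N /\ `|x| <= Num.sqrt N%:R :> R by near: N.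
    have [kN] := nearest_grid_cell _ _ N0 xN; rewrite -/(k N) => xk.
    have /andP[lo up] := @bin_to_gauss_estimate R N (k N) kN.
    apply/andP; split=> //; apply: le_trans lo; rewrite lerD2l lerN2 -!(mulrA 4) ler_wpM2l//.
    have s0 : 0 < Num.sqrt N%:R :> R by exact: sqrt_natr_gt0.
    set s := Num.sqrt _ in s0 *.
    have ss : s ^+ 2 = N%:R by rewrite /s sqr_sqrtr.
    have s1 : 1 <= s by rewrite /s -[leLHS]sqrtr1 ler_wsqrtr// ler1n.
    have zE : 2 * (k N)%:R - N%:R = z N * s by rewrite /z /grid divfK// gt_eqF.
    have zx : `|z N| <= `|x| + 2.
      move: xk; rewrite /cell/= in_itv/= -/(z N) -/s => /andP[z1 z2].
      have : 2 / s <= 2 by rewrite ler_pdivrMr//; lra.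
      have := ler_norm x; have := ler_norm (- x); rewrite normrN.
      by rewrite ler_norml => *; apply/andP; split; lra.
    rewrite zE normrM (gtr0_norm s0) ler_pdivrMr ?exprn_gt0//.
    apply: (@le_trans _ _ (((`|x| + 3) * s) ^+ 3)).
      rewrite lerXn2r ?nnegrE ?addr_ge0 ?mulr_ge0 ?(ltW s0)//.
      by rewrite (le_trans (lerD (ler_wpM2r (ltW s0) zx) s1))//; lra.
    rewrite exprMn -[leRHS]mulrA ler_wpM2l ?exprn_ge0 ?addr_ge0//.
    rewrite [leRHS]mulrC ler_pdivlMr// -exprSr -[in leRHS]natr1 -ss.
    have : 0 < s ^+ 2 by rewrite exprn_gt0.
    by rewrite (_ : s ^+ 4 = s ^+ 2 * s ^+ 2); [nra|ring].
  - rewrite -[X in _ --> X]subr0 -[X in _ --> _ - X](mulr0 (4 * (`|x| + 3) ^+ 3)).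
    by apply: cvgB; [exact: cvg_cst|apply: cvgMr; exact: cvg_invr_sqrt_natr].
  - exact: cvg_cst.
have cvg_main : rho N * expR ((b_ N - N%:R / N.+1%:R) * z N ^+ 2 / 2) * \1_A (z N)
    @[N --> \oo] --> 1 * expR ((b - 1) * x ^+ 2 / 2) * \1_A x.
  apply: cvgM; last exact: continuous_cvg.
  apply: cvgM => //; apply: continuous_cvg; first exact: continuous_expR.
  apply: cvgMl; apply: cvgM; first by apply: cvgB => //; exact: cvg_natr_ratio.
  by rewrite expr2; apply: cvgM.
rewrite mul1r in cvg_main; apply: cvg_trans cvg_main; apply: near_eq_cvg; near=> N.
have [N0 xN] : (0 < N)%N /\ `|x| <= Num.sqrt N%:R :> R by near: N.
have [kN xk] := nearest_grid_cell _ _ N0 xN.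
by rewrite (cw_stepE _ _ _ _ _ N0 kN xk) cw_weightE.
Unshelve. all: by end_near. Qed.

(** An integrable bound uniform in [N]. For [N >= 4] a cell has width at most 1, so its grid point
    [g] satisfies [x ^+ 2 <= 2 * g ^+ 2 + 2]; this trades [g] for [x] at the price of half the rate
    and the factor [expR (a / 2)]. *)
Lemma cw_step_le b A N x a : (4 <= N)%N -> 0 <= a -> b - N%:R / N.+1%:R <= - a ->
  0 <= cw_step b A N x <= expR (a / 2) * expR (- (a / 2 * x ^+ 2 / 2)).
Proof.
move=> N4 a0 ba; have N0 : (0 < N)%N by exact: leq_trans N4.
have [[k kN xk]|/(cw_step0 b A N x) ->] := pselect (exists2 k, (k <= N)%N & cell N k x);
  last by rewrite lexx mulr_ge0// expR_ge0.
rewrite (cw_stepE _ _ _ _ _ N0 kN xk) cw_weight_ge0/= cw_weightE//.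
have /andP[_ r1] := @bin_to_gauss_estimate R N k kN.
have r0 : 0 <= bin_to_gauss N k / bin_to_gauss N (uphalf N) :> R.
  by rewrite divr_ge0 ?ltW ?bin_to_gauss_gt0//; lia.
rewrite -[leRHS]mulr1; apply: ler_pM.
- by rewrite mulr_ge0 ?expR_ge0.
- by rewrite indicE.
- rewrite -[leRHS]mul1r; apply: ler_pM; rewrite ?expR_ge0//.
  rewrite -expRD ler_expR.
  set g := grid N k; set c := b - _ in ba *.
  have h2 : 2 / Num.sqrt N%:R <= 1 :> R.
    rewrite ler_pdivrMr ?sqrt_natr_gt0// mul1r -[leLHS]ger0_norm// -sqrtr_sqr.
    by rewrite ler_wsqrtr// -natrX ler_nat.
  move: xk; rewrite /cell/= in_itv/= -/g => /andP[g1 g2].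
  have xg : x ^+ 2 <= 2 * g ^+ 2 + 2.
    have : 0 <= (x - 2 * g) ^+ 2 by exact: sqr_ge0.
    nra.
  have : c * g ^+ 2 <= - a * g ^+ 2 by rewrite ler_wpM2r// sqr_ge0.
  have : a * x ^+ 2 <= a * (2 * g ^+ 2 + 2) by rewrite ler_wpM2l.
  lra.
- by rewrite indicE; case: (_ \in _).
Qed.

End CurieWeissPointwiseLimit.

(** * Dominated convergence of Curie-Weiss sums to Gaussian integrals *)

Section CurieWeissGaussianLimit.
Context {R : realType}.
Implicit Types (N k : nat) (a b x : R) (A : set R).

Lemma sqrt_inv_gt0 a : 0 < a -> 0 < Num.sqrt (1 / a).
Proof. by move=> a0; rewrite sqrtr_gt0 divr_gt0. Qed.

Lemma normal_pdf_sqrt_inv a x : 0 < a ->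
  normal_pdf 0 (Num.sqrt (1 / a)) x =
  normal_peak (Num.sqrt (1 / a)) * expR (- (a * x ^+ 2 / 2)).
Proof.
move=> a0; rewrite normal_pdfE ?gt_eqF ?sqrt_inv_gt0//; congr (_ * expR _).
rewrite sqr_sqrtr ?divr_ge0 ?(ltW a0)// subr0 -mulr_natl.
by have a0' := lt0r_neq0 a0; field.
Qed.

Lemma normal_peak_sqrt_inv_gt0 a : 0 < a -> 0 < normal_peak (Num.sqrt (1 / a)).
Proof. by move=> a0; rewrite normal_peak_gt0// gt_eqF// sqrt_inv_gt0. Qed.

Lemma integrable_expR_sqr a : 0 < a ->
  lebesgue_measure.-integrable setT (fun x => (expR (- (a * x ^+ 2 / 2)))%:E).
Proof.
move=> a0; have p0 := normal_peak_sqrt_inv_gt0 _ a0.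
have -> : (fun x => (expR (- (a * x ^+ 2 / 2)))%:E) = (fun x =>
    (normal_peak (Num.sqrt (1 / a)))^-1%:E *
    (normal_pdf 0 (Num.sqrt (1 / a)) x)%:E)%E.
  apply/funext => x; rewrite -EFinM normal_pdf_sqrt_inv// mulKf//.
  by rewrite gt_eqF.
by apply: integrableZl => //; exact: integrable_normal_pdf.
Qed.

Lemma integral_expR_sqr a A : 0 < a -> measurable A ->
  (\int[lebesgue_measure]_x (expR (- (a * x ^+ 2 / 2)) * \1_A x)%:E =
   ((normal_peak (Num.sqrt (1 / a)))^-1)%:E *
     normal_prob 0 (Num.sqrt (1 / a)) A)%E.
Proof.
move=> a0 mA; have p0 := normal_peak_sqrt_inv_gt0 _ a0.
rewrite /normal_prob -integralZl//; last first.
  by apply: (@integrableS _ _ _ _ setT) => //; exact: integrable_normal_pdf.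
rewrite [RHS]integral_mkcond; apply: eq_integral => x _.
rewrite patchE indicE; case: ifPn => xA; last by rewrite mulr0.
by rewrite normal_pdf_sqrt_inv// -EFinM mulKf ?mulr1// gt_eqF.
Qed.

(** Dominated convergence for the step functions; the one point [t] where the indicator may jump is
    Lebesgue-null. *)
Lemma cw_sum_cvg (b_ : nat -> R) b A (t : R) : b_ @ \oo --> b -> b < 1 ->
  measurable A -> (forall x, x <> t -> {for x, continuous (\1_A : R -> R)}) ->
  cw_sum (b_ N) A N @[N --> \oo] -->
  (normal_peak (Num.sqrt (1 / (1 - b))))^-1 *
    fine (normal_prob 0 (Num.sqrt (1 / (1 - b))) A).
Proof.
move=> bb b1 mA cA.
(* Half of the gap [1 - b]: eventually [b_ N - N / (N + 1)], whose limit is [b - 1], lies below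
   [- a]. *)
pose a := (1 - b) / 2.
have a0 : 0 < a by rewrite /a; lra.
have [M _ HM] : \forall N \near \oo, (4 <= N)%N /\ b_ N - N%:R / N.+1%:R <= - a.
  have h : b_ N - N%:R / N.+1%:R @[N --> \oo] --> b - 1.
    by apply: cvgB => //; exact: cvg_natr_ratio.
  near=> N; split; first by near: N; exists 4.
  apply/ltW; near: N; apply: (cvgr_lt _ h); rewrite /a; lra.
(* The shift by [M] makes the domination hold for every index, not only eventually. *)
pose f N x := (cw_step (b_ (N + M)%N) A (N + M)%N x)%:E.
have mf : forall N, measurable_fun setT (f N).
  by move=> N; apply/measurable_EFinP; exact: measurable_cw_step.
have mg : measurable_fun setT (fun x => (expR (- ((1 - b) * x ^+ 2 / 2)) * \1_A x)%:E).
  apply/measurable_EFinP; apply: measurable_funM; last exact: measurable_indic.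
  have := measurable_int _ (integrable_expR_sqr (1 - b) _).
  by move=> /(_ (ltac:(lra)))/measurable_EFinP.
have cvf : {ae lebesgue_measure, forall x, setT x ->
    f ^~ x @ \oo --> (expR (- ((1 - b) * x ^+ 2 / 2)) * \1_A x)%:E}.
  exists [set t]; split => //; first exact: lebesgue_measure_set1.
  move=> x /= xP; apply: contrapT => xt; apply: xP => _.
  apply: cvg_EFin; first exact: nearW.
  rewrite /f/= [X in X @ _](_ : _ = (fun n => cw_step (b_ (n + M)%N) A (n + M)%N x))//.
  rewrite (cvg_shiftn M (fun n => cw_step (b_ n) A n x)).
  have -> : - ((1 - b) * x ^+ 2 / 2) = (b - 1) * x ^+ 2 / 2 by ring.
  by apply: cw_step_cvg => //; exact: cA.
have ig : lebesgue_measure.-integrable setT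
    (fun x => (expR (a / 2))%:E * (expR (- (a / 2 * x ^+ 2 / 2)))%:E)%E.
  by apply: integrableZl => //; apply: integrable_expR_sqr; lra.
have dom : {ae lebesgue_measure, forall x (n : nat), setT x ->
   (`|f n x| <= (expR (a / 2))%:E * (expR (- (a / 2 * x ^+ 2 / 2)))%:E)%E}.
  apply: aeW => x n _; rewrite -EFinM/= lee_fin.
  have [N4 ba] := HM (n + M)%N (leq_addl _ _).
  have /andP[h0 h1] := cw_step_le _ A _ x a N4 (ltW a0) ba.
  by rewrite ger0_norm.
have [_ _ /= cvI] := @dominated_convergence _ _ R lebesgue_measure setT measurableT
  f _ _ mf mg cvf ig dom.
rewrite integral_expR_sqr in cvI => //; last lra.
set s := Num.sqrt _ in cvI *.
have fn : normal_prob 0 s A \is a fin_num by exact: fin_num_measure.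
rewrite -(fineK fn) -EFinM in cvI.
have fE : (fun n => (\int[lebesgue_measure]_x f n x)%E) =
    (fun n => (cw_sum (b_ (n + M)%N) A (n + M) : R)%:E).
  apply/funext => n; rewrite /f integral_cw_step//.
  by have [N4 _] := HM (n + M)%N (leq_addl _ _); exact: leq_trans N4.
rewrite fE in cvI; have h := fine_cvg cvI.
by rewrite -(cvg_shiftn M (fun N => cw_sum (b_ N) A N : R)); exact: h.
Unshelve. all: by end_near. Qed.

End CurieWeissGaussianLimit.

(** * Averages over uniformly distributed configurations *)

Section CurieWeissAverage.
Context {R : realType}.
Implicit Types (N k : nat) (b : R) (A : set R).

Lemma magnetization_grid N (S : {set 'I_N}) :
  magnetization R [ffun i => i \in S] = grid N #|S|.
Proof.
rewrite /magnetization /grid mulrC mulrA mulr1; congr (_ / _).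
rewrite (bigID (mem S))/=.
rewrite (eq_bigr (fun=> 1)); last by move=> i iS; rewrite /spin ffunE iS.
rewrite [X in _ + X](eq_bigr (fun=> -1)); last first.
  by move=> i iS; rewrite /spin ffunE (negbTE iS).
have -> : N%:R = #|S|%:R + #|[predC S]|%:R :> R by rewrite -natrD cardC card_ord.
rewrite sumrN !sumr_const; ring.
Qed.

(** Configurations are reindexed by their set of positive spins and grouped by its cardinality. *)
Lemma sum_magnetization N (h : R -> R) :
  \sum_(s : {ffun 'I_N -> bool}) h (magnetization R s) =
  \sum_(k < N.+1) 'C(N, k)%:R * h (grid N k).
Proof.
rewrite (reindex_onto (fun S : {set 'I_N} => [ffun i => i \in S])
  (fun s => [set i | s i]%SET))/=; last first.
  by move=> s _; apply/ffunP => i; rewrite ffunE inE.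
rewrite (eq_bigl xpredT); last first.
  by move=> S /=; apply/eqP/setP => i; rewrite inE ffunE.
under eq_bigr do rewrite magnetization_grid.
rewrite (partition_big (fun S : {set 'I_N} => inord #|S| : 'I_N.+1) xpredT)//=.
apply: eq_bigr => k _.
have cardk (S : {set 'I_N}) : (inord #|S| == k) = (#|S| == k).
  rewrite -val_eqE/= inordK// ltnS -[leqRHS](card_ord N) max_card//.
rewrite (eq_bigr (fun=> h (grid N k))); last first.
  by move=> S; rewrite cardk => /eqP ->.
have -> : 'C(N, k) = #|[pred S : {set 'I_N} | inord #|S| == k]|.
  rewrite -[X in 'C(X, _)](card_ord N) -card_draws cardsE; apply: eq_card => S.
  by rewrite !inE cardk.
by rewrite sumr_const mulr_natl.
Qed.

Definition cw_avg b A N : R := (2 ^+ N)^-1 * \sum_(s : {ffun 'I_N -> bool})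
  expR (b * magnetization R s ^+ 2 / 2) * \1_A (magnetization R s).

(** At [b = 0] with no restriction the binomial theorem evaluates the sum to [2 ^+ N] over the
    central [bin_to_gauss]; in the quotient this central value and the mesh cancel. *)
Lemma cw_avgE b A N : (0 < N)%N -> cw_avg b A N = cw_sum b A N / cw_sum 0 setT N.
Proof.
move=> N0; rewrite /cw_avg (sum_magnetization N
  (fun x => expR (b * x ^+ 2 / 2) * \1_A x)).
rewrite /cw_sum /cw_weight -!mulr_suml.
set q := bin_to_gauss N (uphalf N).
have q0 : q != 0 :> R by apply/lt0r_neq0/bin_to_gauss_gt0; lia.
have s0 : Num.sqrt N%:R != 0 :> R by apply/lt0r_neq0/sqrt_natr_gt0.
have -> : \sum_(i < N.+1) 'C(N, i)%:R / q * expR (0 * grid N i ^+ 2 / 2) *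
    \1_[set: R] (grid N i) = 2 ^+ N / q.
  under eq_bigr do rewrite !mul0r expR0 indicT !mulr1.
  rewrite -mulr_suml -natr_sum; congr (_ / _).
  rewrite -natrX -[in RHS](addn1 1) expnDn; congr (_%:R).
  by apply: eq_bigr => i _; rewrite !exp1n !muln1.
have -> : \sum_(i < N.+1) 'C(N, i)%:R / q * expR (b * grid N i ^+ 2 / 2) *
    \1_A (grid N i) = (\sum_(i < N.+1) 'C(N, i)%:R * (expR (b * grid N i ^+ 2 / 2) *
    \1_A (grid N i))) / q.
  by rewrite mulr_suml; apply: eq_bigr => i _; ring.
set T := \sum_(i < _) _.
have t0 : 2 ^+ N != 0 :> R by rewrite expf_neq0.
by field; rewrite q0 s0.
Qed.

(* The limit [(1 - b)^(-1/2)] of [cw_avg b setT N], left as a quotient of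
   normalizing constants. *)
Definition cw_const b : R :=
  normal_peak (Num.sqrt (1 / (1 - 0))) / normal_peak (Num.sqrt (1 / (1 - b))).

Lemma cw_const_gt0 b : b < 1 -> 0 < cw_const b.
Proof. by move=> b1; rewrite divr_gt0// normal_peak_sqrt_inv_gt0//; lra. Qed.

Lemma indicT_continuous (x : R) : {for x, continuous (\1_[set: R] : R -> R)}.
Proof. by rewrite indicT; exact: cvg_cst. Qed.

Lemma cw_avg_cvg (b_ : nat -> R) b A (t : R) : b_ @ \oo --> b -> b < 1 ->
  measurable A -> (forall x, x <> t -> {for x, continuous (\1_A : R -> R)}) ->
  cw_avg (b_ N) A N @[N --> \oo] -->
  cw_const b * fine (normal_prob 0 (Num.sqrt (1 / (1 - b))) A).
Proof.
move=> bb b1 mA cA.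
have n0 : normal_peak (Num.sqrt (1 / (1 - 0))) != 0 :> R.
  by apply/lt0r_neq0/normal_peak_sqrt_inv_gt0; lra.
have d : cw_sum 0 [set: R] N @[N --> \oo] -->
    ((normal_peak (Num.sqrt (1 / (1 - 0))))^-1 : R).
  have c0 : (fun=> 0 : R) x @[x --> \oo] --> (0 : R) by exact: cvg_cst.
  have := @cw_sum_cvg _ (fun=> 0) 0 [set: R] 0 c0 ltr01 measurableT
    (fun x _ => indicT_continuous x).
  by rewrite probability_setT/= mulr1.
have -> : cw_const b * fine (normal_prob 0 (Num.sqrt (1 / (1 - b))) A) =
    (normal_peak (Num.sqrt (1 / (1 - b))))^-1 *
    fine (normal_prob 0 (Num.sqrt (1 / (1 - b))) A) *
    ((normal_peak (Num.sqrt (1 / (1 - 0))))^-1)^-1.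
  by rewrite invrK /cw_const; ring.
apply: cvg_trans (_ : cw_sum (b_ N) A N / cw_sum 0 [set: R] N @[N --> \oo] --> _).
  apply: near_eq_cvg.
  by near=> N; rewrite cw_avgE//; near: N; exists 1%N.
apply: cvgM; first exact: cw_sum_cvg bb b1 mA cA.
exact: cvgV (invr_neq0 n0) d.
Unshelve. all: by end_near. Qed.

Lemma cw_avgT_cvg (b_ : nat -> R) b : b_ @ \oo --> b -> b < 1 ->
  cw_avg (b_ N) setT N @[N --> \oo] --> cw_const b.
Proof.
move=> bb b1; have := @cw_avg_cvg b_ b [set: R] 0 bb b1 measurableT
  (fun x _ => indicT_continuous x).
by rewrite probability_setT/= mulr1.
Qed.

Lemma indic_itvNyc_continuous (t x : R) : x <> t ->
  {for x, continuous (\1_(`]-oo, t]) : R -> R)}.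
Proof.
move=> /eqP; rewrite neq_lt => /orP[xt|tx].
  apply: (near_cst_continuous (1 : R)); have := lt_nbhsl xt; apply: filterS => y yt.
  by rewrite indicE mem_set//= in_itv/= ltW.
apply: (near_cst_continuous (0 : R)); have := lt_nbhsr tx; apply: filterS => y ty.
by rewrite indicE memNset//= in_itv/=; apply/negP; rewrite -ltNge.
Qed.

End CurieWeissAverage.

(** * Moments of partition functions over the random edges *)

Section ErdosRenyiMoments.
Context {R : realType}.
Implicit Types (N : nat) (p b x beta theta : R) (A : set R).

Definition er_weight N p (c : {ffun 'I_N * 'I_N -> bool}) : R :=
  \prod_ij (if c ij then p else 1 - p).

Definition er_mean N p (F : {ffun 'I_N * 'I_N -> bool} -> R) : R :=
  \sum_c er_weight N p c * F c.

Definition er_edge N (c : {ffun 'I_N * 'I_N -> bool}) (i j : 'I_N) : R :=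
  (c (i, j))%:R.

Lemma er_weight_ge0 N p c : 0 <= p <= 1 -> 0 <= er_weight N p c.
Proof.
by move=> /andP[p0 p1]; apply: prodr_ge0 => ij _; case: (c ij) => //; rewrite subr_ge0.
Qed.

(** Independence of the edges in finite form: a sum over configurations of a product over edges is
    the product over edges of two-term sums. *)
Lemma er_mean_expR N p (x : 'I_N * 'I_N -> R) :
  er_mean N p (fun c => expR (\sum_ij er_edge N c ij.1 ij.2 * x ij)) =
  \prod_ij (1 - p + p * expR (x ij)).
Proof.
rewrite /er_mean /er_weight.
transitivity (\sum_(c : {ffun 'I_N * 'I_N -> bool})
    \prod_ij ((if c ij then p else 1 - p) * expR ((c ij)%:R * x ij))).
  apply: eq_bigr => c _; rewrite expR_sum -big_split/=.
  by apply: eq_bigr => -[i j] _.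
rewrite -(bigA_distr_bigA (fun ij (v : bool) =>
  (if v then p else 1 - p) * expR (v%:R * x ij))).
apply: eq_bigr => ij _; rewrite big_bool/= mul1r mul0r expR0 mulr1.
by rewrite addrC.
Qed.

Lemma er_mean_cst N p x : er_mean N p (fun=> x) = x.
Proof.
rewrite /er_mean -mulr_suml.
have := er_mean_expR N p (fun=> 0); rewrite /er_mean => h.
suff -> : \sum_c er_weight N p c = 1 by rewrite mul1r.
transitivity (\prod_(ij : 'I_N * 'I_N) (1 - p + p * expR 0)).
  rewrite -h; apply: eq_bigr => c _.
  by rewrite big1 ?expR0 ?mulr1// => ij _; rewrite mulr0.
by rewrite big1// => ij _; rewrite expR0; ring.
Qed.

Lemma er_mean_sum N p (I : finType) (F : I -> {ffun 'I_N * 'I_N -> bool} -> R) :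
  er_mean N p (fun c => \sum_i F i c) = \sum_i er_mean N p (F i).
Proof. by rewrite /er_mean exchange_big/=; apply: eq_bigr => c _; rewrite mulr_sumr. Qed.

Lemma er_meanZ N p k (F : {ffun 'I_N * 'I_N -> bool} -> R) :
  er_mean N p (fun c => F c * k) = er_mean N p F * k.
Proof. by rewrite /er_mean mulr_suml; apply: eq_bigr => c _; rewrite mulrA. Qed.

Lemma er_meanD N p (F G : {ffun 'I_N * 'I_N -> bool} -> R) :
  er_mean N p (fun c => F c + G c) = er_mean N p F + er_mean N p G.
Proof. by rewrite /er_mean -big_split/=; apply: eq_bigr => c _; rewrite mulrDr. Qed.

Lemma le_er_mean N p (F G : {ffun 'I_N * 'I_N -> bool} -> R) : 0 <= p <= 1 ->
  (forall c, F c <= G c) -> er_mean N p F <= er_mean N p G.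
Proof.
by move=> p01 FG; apply: ler_sum => c _; rewrite ler_wpM2l// er_weight_ge0.
Qed.

Definition er_logmgf p x : R := ln (1 - p + p * expR x).

Definition er_odd p x : R := er_logmgf p x - er_logmgf p (- x).

Definition er_even p x : R := er_logmgf p x + er_logmgf p (- x).

Lemma er_logmgf_arg_gt0 p x : 0 < p <= 1 -> 0 < 1 - p + p * expR x.
Proof.
move=> /andP[p0 p1]; have : 0 < p * expR x by rewrite mulr_gt0// expR_gt0.
lra.
Qed.

Lemma er_mean_expR_logmgf N p (x : 'I_N * 'I_N -> R) : 0 < p <= 1 ->
  er_mean N p (fun c => expR (\sum_ij er_edge N c ij.1 ij.2 * x ij)) =
  expR (\sum_ij er_logmgf p (x ij)).
Proof.
move=> p01; rewrite er_mean_expR expR_sum; apply: eq_bigr => ij _.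
by rewrite /er_logmgf lnK// posrE er_logmgf_arg_gt0.
Qed.

Definition edge_coupling N p beta : R := beta / (2 * N%:R * p).

Lemma hamiltonianE N p beta (e : 'I_N -> 'I_N -> R) s :
  - beta * hamiltonian p e s =
  \sum_ij e ij.1 ij.2 * (edge_coupling N p beta * (spin R s ij.1 * spin R s ij.2)).
Proof.
rewrite /hamiltonian mulNr mulNr mulrN opprK pair_bigA/= mulrA mulr_sumr.
by apply: eq_bigr => ij _; rewrite /edge_coupling; ring.
Qed.

Lemma sum_spin_pairs N (s : {ffun 'I_N -> bool}) : (0 < N)%N ->
  \sum_ij spin R s ij.1 * spin R s ij.2 = N%:R * magnetization R s ^+ 2.
Proof.
move=> N0; rewrite -(pair_bigA _ (fun i j => spin R s i * spin R s j))/=.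
under eq_bigr do rewrite -mulr_sumr.
rewrite -mulr_suml /magnetization exprMn div1r exprVn sqr_sqrtr// mulrA.
by rewrite mulfV ?mul1r ?expr2// pnatr_eq0 -lt0n.
Qed.

(** With booleans as signs, equality is multiplication. The magnetization of [spin_mul N s t] is the
    normalized overlap of [s] and [t]. *)
Definition spin_mul N (s t : {ffun 'I_N -> bool}) : {ffun 'I_N -> bool} :=
  [ffun i => s i == t i].

Lemma spin_spin_mul N (s t : {ffun 'I_N -> bool}) i :
  spin R (spin_mul N s t) i = spin R s i * spin R t i.
Proof. by rewrite /spin ffunE; case: (s i); case: (t i) => /=; ring. Qed.

Lemma spin_mulK N (s : {ffun 'I_N -> bool}) : involutive (spin_mul N s).
Proof. by move=> t; apply/ffunP => i; rewrite !ffunE; case: (s i); case: (t i). Qed.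

Lemma spin_pair_sqr N (s : {ffun 'I_N -> bool}) i j :
  spin R s i * spin R s j = 1 \/ spin R s i * spin R s j = -1.
Proof. by rewrite /spin; case: (s i); case: (s j); [left|right|right|left]; ring. Qed.

Lemma card_pairs N : \sum_(ij : 'I_N * 'I_N) 1 = N%:R ^+ 2 :> R.
Proof. by rewrite sumr_const card_prod card_ord natrM expr2. Qed.

(** Any function of a sign is affine, here with mean [er_even p g / 2] and slope [er_odd p g / 2];
    the sign products then sum to [N] times the squared magnetization. *)
Lemma sum_logmgf_spin N p (g : R) (s : {ffun 'I_N -> bool}) : (0 < N)%N ->
  \sum_ij er_logmgf p (g * (spin R s ij.1 * spin R s ij.2)) =
  N%:R ^+ 2 * (er_even p g / 2) +
  N%:R * er_odd p g * magnetization R s ^+ 2 / 2.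
Proof.
move=> N0; rewrite /er_even /er_odd.
transitivity (\sum_(ij : 'I_N * 'I_N) (1 * ((er_logmgf p g + er_logmgf p (- g)) / 2) +
   spin R s ij.1 * spin R s ij.2 * ((er_logmgf p g - er_logmgf p (- g)) / 2))).
  apply: eq_bigr => ij _.
  by case: (spin_pair_sqr N s ij.1 ij.2) => ->; rewrite ?mulr1 ?mulrN1; field.
by rewrite big_split/= -!mulr_suml card_pairs sum_spin_pairs//; field.
Qed.

(** For two signs the argument is [2 g], 0 or [- 2 g]. As [er_logmgf] vanishes at 0, it is a
    combination of 1, the two signs and their product, and the product yields the overlap. *)
Lemma sum_logmgf_spin2 N p (g : R) (s t : {ffun 'I_N -> bool}) : (0 < N)%N ->
  \sum_ij er_logmgf p (g * (spin R s ij.1 * spin R s ij.2)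
                     + g * (spin R t ij.1 * spin R t ij.2)) =
  N%:R ^+ 2 * (er_even p (2 * g) / 4) +
  N%:R * (er_odd p (2 * g) / 2) *
    (magnetization R s ^+ 2 + magnetization R t ^+ 2) / 2 +
  N%:R * (er_even p (2 * g) / 2) *
    magnetization R (spin_mul N s t) ^+ 2 / 2.
Proof.
move=> N0.
have l0 : er_logmgf p 0 = 0 by rewrite /er_logmgf expR0 mulr1 subrK ln1.
rewrite /er_even /er_odd; set a := er_logmgf p (2 * g); set b := er_logmgf p (- (2 * g)).
transitivity (\sum_(ij : 'I_N * 'I_N) (1 * ((a + b) / 4) +
  (spin R s ij.1 * spin R s ij.2 * ((a - b) / 4) +
   spin R t ij.1 * spin R t ij.2 * ((a - b) / 4)) +
  spin R (spin_mul N s t) ij.1 * spin R (spin_mul N s t) ij.2 * ((a + b) / 4))).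
  apply: eq_bigr => ij _; rewrite !spin_spin_mul.
  rewrite (mulrACA _ _ (spin R s ij.2)).
  by case: (spin_pair_sqr N s ij.1 ij.2) => ->; case: (spin_pair_sqr N t ij.1 ij.2) => ->;
    rewrite ?mulr1 ?mulrN1 ?subrr ?addNr ?l0 -?opprD -?mulr2n -?(mulr_natl g) -/a -/b; field.
by rewrite !big_split/= -!mulr_suml card_pairs !sum_spin_pairs//; field.
Qed.

Definition gibbs_sum N p beta A (e : 'I_N -> 'I_N -> R) : R :=
  \sum_(s : {ffun 'I_N -> bool})
    expR (- beta * hamiltonian p e s) * \1_A (magnetization R s).

(** The configuration-independent part of the mean of the partition function. *)
Definition gibbs_scale N p beta : R :=
  2 ^+ N * expR (N%:R ^+ 2 * (er_even p (edge_coupling N p beta) / 2)).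

Lemma gibbs_scale_gt0 N p beta : 0 < gibbs_scale N p beta.
Proof. by rewrite mulr_gt0 ?expR_gt0// exprn_gt0. Qed.

Lemma gibbs_first_moment N p beta A : (0 < N)%N -> 0 < p <= 1 ->
  er_mean N p (fun c => gibbs_sum N p beta A (er_edge N c) / gibbs_scale N p beta) =
  cw_avg (N%:R * er_odd p (edge_coupling N p beta)) A N.
Proof.
move=> N0 p01; set g := edge_coupling N p beta; rewrite er_meanZ /gibbs_sum er_mean_sum.
under eq_bigr => s _.
  rewrite er_meanZ.
  under [X in er_mean _ _ X]eq_fun do rewrite hamiltonianE.
  rewrite er_mean_expR_logmgf// sum_logmgf_spin// expRD.
  over.
rewrite /cw_avg /gibbs_scale -/g.
under eq_bigr do rewrite -mulrA; rewrite -mulr_sumr.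
have e0 := lt0r_neq0 (expR_gt0 (N%:R ^+ 2 * (er_even p g / 2))).
have t0 : 2 ^+ N != 0 :> R by rewrite expf_neq0.
by set E := expR _ in e0 *; set T := 2 ^+ N in t0 *; field; rewrite t0 e0.
Qed.

(** For fixed [s], multiplication by [s] is an involution of the configurations, so the overlap with
    [s] is distributed like a magnetization. *)
Lemma sum_spin_mul N (h : {ffun 'I_N -> bool} -> R) :
  \sum_s \sum_t h (spin_mul N s t) = 2 ^+ N * \sum_t h t.
Proof.
transitivity (\sum_(s : {ffun 'I_N -> bool}) \sum_t h t).
  apply: eq_bigr => s _; rewrite [RHS](reindex_inj (inv_inj (spin_mulK N s))).
  by [].
have -> : 2 ^+ N = #|{: {ffun 'I_N -> bool}}|%:R :> R.
  by rewrite card_ffun card_bool card_ord natrX.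
by rewrite sumr_const mulr_natl.
Qed.

(** Convexity, from the tangent line of [expR] at [m = u + v]: the deviations [a - m] and [b - m]
    have weighted sum zero. *)
Lemma expR_convex_le theta (u v : R) : 0 < theta < 1 ->
  expR (u + v) <= (1 - theta) * expR (u / (1 - theta)) + theta * expR (v / theta).
Proof.
move=> /andP[t0 t1]; have t1' : 0 < 1 - theta by lra.
set a := u / (1 - theta); set b := v / theta; set m := u + v.
have mE : (1 - theta) * (a - m) + theta * (b - m) = 0.
  by rewrite /a /b /m; field; rewrite !lt0r_neq0.
have ea : expR m * (1 + (a - m)) <= expR a.
  have := expR_ge1Dx (a - m); rewrite -(ler_pM2l (expR_gt0 m)) -expRD.
  by rewrite (_ : m + (a - m) = a)//; ring.
have eb : expR m * (1 + (b - m)) <= expR b.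
  have := expR_ge1Dx (b - m); rewrite -(ler_pM2l (expR_gt0 m)) -expRD.
  by rewrite (_ : m + (b - m) = b)//; ring.
have := lerD (ler_wpM2l (ltW t1') ea) (ler_wpM2l (ltW t0) eb).
apply: le_trans; rewrite le_eqVlt; apply/orP; left; apply/eqP.
transitivity (expR m * (1 + ((1 - theta) * (a - m) + theta * (b - m)))); last by ring.
by rewrite mE; ring.
Qed.

(** [expR_convex_le] splits the exponent. The part in [X ^+ 2 + Y ^+ 2] factorizes over the two
    configurations into a squared average; the overlap part, its indicators bounded by 1, becomes a
    single average through [sum_spin_mul]. *)
Lemma gibbs_second_moment N p beta A theta : (0 < N)%N -> 0 < p <= 1 ->
  0 < theta < 1 ->
  er_mean N p (fun c => (gibbs_sum N p beta A (er_edge N c) / gibbs_scale N p beta) ^+ 2)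
  <= expR (N%:R ^+ 2 * (er_even p (2 * edge_coupling N p beta) / 4
                        - er_even p (edge_coupling N p beta))) *
     ((1 - theta) * cw_avg (N%:R * (er_odd p (2 * edge_coupling N p beta) / 2)
                              / (1 - theta)) A N ^+ 2 +
      theta * cw_avg (N%:R * (er_even p (2 * edge_coupling N p beta) / 2) / theta) setT N).
Proof.
move=> N0 p01 t01; set g := edge_coupling N p beta.
set d := er_odd p (2 * g) / 2; set m := er_even p (2 * g) / 2.
have -> : er_even p (2 * g) / 4 = m / 2 by rewrite /m; field.
have /andP[t0 t1] := t01; have t1' : 0 < 1 - theta by lra.
under [X in er_mean _ _ X]eq_fun do rewrite expr_div_n.
rewrite er_meanZ.
pose ind (s : {ffun 'I_N -> bool}) : R := \1_A (magnetization R s).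
have -> : er_mean N p (fun c => gibbs_sum N p beta A (er_edge N c) ^+ 2) =
  \sum_s \sum_t expR (N%:R ^+ 2 * (m / 2)) *
    (expR (N%:R * d * (magnetization R s ^+ 2 + magnetization R t ^+ 2) / 2 +
      N%:R * m * magnetization R (spin_mul N s t) ^+ 2 / 2) * (ind s * ind t)).
  transitivity (er_mean N p (fun c => \sum_(st : {ffun 'I_N -> bool} * {ffun 'I_N -> bool})
     expR (\sum_ij er_edge N c ij.1 ij.2 *
        (g * (spin R st.1 ij.1 * spin R st.1 ij.2) + g * (spin R st.2 ij.1 * spin R st.2 ij.2)))
      * (ind st.1 * ind st.2))).
    congr er_mean; apply/funext => c.
    rewrite expr2 /gibbs_sum big_distrlr/= pair_bigA/=; apply: eq_bigr => st _.
    rewrite mulrACA -expRD !hamiltonianE -big_split/=; congr (expR _ * _).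
    by apply: eq_bigr => ij _; rewrite -/g mulrDr.
  rewrite [RHS]pair_bigA/= er_mean_sum; apply: eq_bigr => st _.
  rewrite er_meanZ er_mean_expR_logmgf// sum_logmgf_spin2// [RHS]mulrA -expRD.
  by congr (expR _ * _); rewrite /m /d; field.
rewrite [leRHS](_ : _ = \sum_s \sum_t expR (N%:R ^+ 2 * (m / 2)) *
    ((1 - theta) * (expR (N%:R * d / (1 - theta) * magnetization R s ^+ 2 / 2) * ind s *
                   (expR (N%:R * d / (1 - theta) * magnetization R t ^+ 2 / 2) * ind t)) +
     theta * (expR (N%:R * m / theta * magnetization R (spin_mul N s t) ^+ 2 / 2) *
       \1_[set: R] (magnetization R (spin_mul N s t)))) / gibbs_scale N p beta ^+ 2).
  rewrite mulr_suml; apply: ler_sum => s _.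
  rewrite mulr_suml; apply: ler_sum => t _.
  rewrite ler_wpM2r ?invr_ge0 ?exprn_ge0 ?(ltW (gibbs_scale_gt0 _ _ _))//.
  rewrite ler_wpM2l ?expR_ge0//.
  rewrite /ind !indicE in_setT mulr1.
  have [_|_] := boolP (_ \in A); last first.
    by rewrite !(mul0r, mulr0) add0r mulr_ge0 ?expR_ge0// ltW.
  have [_|_] := boolP (_ \in A); last first.
    by rewrite !(mul0r, mulr0) add0r mulr_ge0 ?expR_ge0// ltW.
  rewrite !mulr1 -expRD; apply: le_trans (expR_convex_le _ _ _ t01) _.
  rewrite le_eqVlt; apply/orP; left; apply/eqP; congr (_ * expR _ + _ * expR _).
    by field; rewrite lt0r_neq0.
  by field; rewrite lt0r_neq0.
under eq_bigr => s _ do rewrite -mulr_suml -mulr_sumr big_split/= -!mulr_sumr.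
rewrite -mulr_suml -mulr_sumr big_split/= -!mulr_sumr.
rewrite (sum_spin_mul N (fun s => expR (N%:R * m / theta * magnetization R s ^+ 2 / 2) *
       \1_[set: R] (magnetization R s))) -mulr_suml.
rewrite /cw_avg /gibbs_scale -/g.
set S1 := \sum_(i | _) _; set S2 := \sum_(i | _) _.
set E := expR (N%:R ^+ 2 * (er_even p g / 2)).
have -> : N%:R ^+ 2 * (m / 2 - er_even p g) =
  N%:R ^+ 2 * (m / 2) + (- (N%:R ^+ 2 * (er_even p g / 2))) +
  (- (N%:R ^+ 2 * (er_even p g / 2))) by field.
rewrite !expRD expRN -/E.
have e0 : E != 0 by apply/lt0r_neq0/expR_gt0.
have t0' : 2 ^+ N != 0 :> R by rewrite expf_neq0.
set T := 2 ^+ N in t0' *; set K := expR _.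
by field; rewrite t0' e0.
Qed.

End ErdosRenyiMoments.

(** * Asymptotics of the effective couplings *)

Section LogMgfExpansion.
Context {R : realType}.
Implicit Types p x : R.

(** From [expR x * (1 - x) <= 1] and [(1 + x + 2 x ^+ 2) (1 - x) = 1 + x ^+ 2 (1 - 2 x) >= 1]. *)
Lemma expR_sub1_le x : `|x| <= 1 / 2 -> expR x - 1 <= x + 2 * x ^+ 2.
Proof.
rewrite ler_norml => /andP[x1 x2].
have h : expR x * (1 - x) <= 1.
  rewrite -[leRHS](expRxMexpNx_1 x) ler_wpM2l ?expR_ge0//.
  by have := expR_ge1Dx (- x); lra.
have : expR x <= (1 + x + 2 * x ^+ 2).
  rewrite -(@ler_pM2r _ (1 - x)); last lra.
  by apply: le_trans h _; nra.
lra.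
Qed.

(** The left side is [x / (1 + x)]; apply the upper bound [ln (1 + y) <= y] to the inverse of
    [1 + x]. *)
Lemma ln1D_ge x : -1 < x -> x - x ^+ 2 / (1 + x) <= ln (1 + x).
Proof.
move=> x1; have x0 : 0 < 1 + x by lra.
have -> : x - x ^+ 2 / (1 + x) = - (- x / (1 + x)) by field; rewrite lt0r_neq0.
rewrite lerNl -lnV ?posrE//.
have e : - x / (1 + x) = (1 + x)^-1 - 1 by field; rewrite lt0r_neq0.
have i0 : 0 < (1 + x)^-1 by rewrite invr_gt0.
rewrite e; have := @le_ln1Dx R ((1 + x)^-1 - 1).
by rewrite addrCA subrr addr0; apply; lra.
Qed.

(** The error must keep a factor [p]. With [y = p * (expR x - 1)], the bounds [p ^+ 2 <= p] and
    [1 + y >= 1 / 2] turn [y ^+ 2 / (1 + y)] into at most [8 p x ^+ 2]. *)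
Lemma er_logmgf_approx p x : 0 < p <= 1 -> `|x| <= 1 / 2 ->
  `|er_logmgf p x - p * x| <= 8 * p * x ^+ 2.
Proof.
move=> /andP[p0 p1] x12; have := x12; rewrite ler_norml => /andP[x1 x2].
have e1 := expR_sub1_le x x12.
have e2 := expR_ge1Dx x.
pose y := p * (expR x - 1).
have yE : 1 - p + p * expR x = 1 + y by rewrite /y; ring.
have y2 : -(1/2) <= y by rewrite /y; nra.
have x20 : 0 <= x ^+ 2 by exact: sqr_ge0.
rewrite /er_logmgf yE ler_distl; apply/andP; split.
  have yx : p * x <= y by rewrite /y ler_wpM2l ?(ltW p0)//; lra.
  have yy : y ^+ 2 <= 4 * p * x ^+ 2.
    have a : `|expR x - 1| <= 2 * `|x|.
      have [x0|x0] := leP 0 x.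
        by rewrite ger0_norm ?(ger0_norm x0); nra.
      rewrite (ltr0_norm x0) ler0_norm; first lra.
      by rewrite subr_le0 expR_le1 ltW.
    have b : (expR x - 1) ^+ 2 <= 4 * x ^+ 2.
      rewrite -(real_normK (num_real (expR x - 1))) -(real_normK (num_real x)).
      rewrite (_ : 4 * `|x| ^+ 2 = (2 * `|x|) ^+ 2); last by ring.
      by rewrite lerXn2r ?nnegrE ?mulr_ge0.
    have c : p ^+ 2 <= p by nra.
    rewrite /y exprMn.
    have := ler_wpM2l (sqr_ge0 p) b; have := ler_wpM2r x20 c; lra.
  have : y ^+ 2 / (1 + y) <= 8 * p * x ^+ 2.
    rewrite ler_pdivrMr; last lra.
    have : 0 <= p * x ^+ 2 by rewrite mulr_ge0// ltW.
    nra.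
  have := ln1D_ge y; lra.
apply: le_trans (le_ln1Dx _) _; first lra.
have := ler_wpM2l (ltW p0) e1.
have : 0 <= p * x ^+ 2 by rewrite mulr_ge0// ltW.
rewrite /y; lra.
Qed.

Lemma er_odd_approx p x : 0 < p <= 1 -> `|x| <= 1 / 2 ->
  `|er_odd p x - 2 * p * x| <= 16 * p * x ^+ 2.
Proof.
move=> p01 x12; have := er_logmgf_approx p x p01 x12.
have := er_logmgf_approx p (- x) p01; rewrite normrN sqrrN => /(_ x12).
rewrite !ler_norml /er_odd => /andP[? ?] /andP[? ?]; apply/andP; split; lra.
Qed.

Lemma er_even_approx p x : 0 < p <= 1 -> `|x| <= 1 / 2 ->
  `|er_even p x| <= 16 * p * x ^+ 2.
Proof.
move=> p01 x12; have := er_logmgf_approx p x p01 x12.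
have := er_logmgf_approx p (- x) p01; rewrite normrN sqrrN => /(_ x12).
rewrite !ler_norml /er_even => /andP[? ?] /andP[? ?]; apply/andP; split; lra.
Qed.

Lemma er_evenE p x : 0 < p <= 1 ->
  er_even p x = ln (1 + p * (1 - p) * (expR x + expR (- x) - 2)).
Proof.
move=> p01; rewrite /er_even /er_logmgf -lnM ?posrE ?er_logmgf_arg_gt0//.
congr ln; have := expRxMexpNx_1 x => e.
transitivity ((1 - p) ^+ 2 + p ^+ 2 * (expR x * expR (- x)) +
  p * (1 - p) * (expR x + expR (- x))); first by ring.
by rewrite e; ring.
Qed.

(* The quadratic Taylor terms of [er_even p (2 x)] and [4 * er_even p x]
   coincide, so that only a term of order [p * x ^+ 4] survives. *)
Lemma er_even_double p x : 0 < p <= 1 -> `|x| <= 1 / 2 ->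
  er_even p (2 * x) - 4 * er_even p x <= 80 * p * x ^+ 4.
Proof.
move=> p01 x12; have /andP[p0 p1] := p01; rewrite !er_evenE//.
set h := expR x + expR (- x) - 2.
have h4 : h <= 4 * x ^+ 2.
  have := expR_sub1_le x x12; have := expR_sub1_le (- x).
  by rewrite normrN sqrrN /h => /(_ x12); lra.
have xx := expRxMexpNx_1 x.
have h0 : 0 <= h.
  have := sqr_ge0 (expR (x / 2) - expR (- (x / 2))).
  rewrite sqrrB -!expRM_natl -expRD subrr expR0.
  rewrite (_ : 2 * (x / 2) = x); last by field.
  by rewrite (_ : 2 * - (x / 2) = - x) /h; [lra|field].
have e2 : expR (2 * x) = expR x ^+ 2 by rewrite expRM_natl.
have e2' : expR (- (2 * x)) = expR (- x) ^+ 2 by rewrite -mulrN expRM_natl.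
(* The double-angle formula for the hyperbolic cosine, with [h = 2 cosh x - 2]. *)
have -> : expR (2 * x) + expR (- (2 * x)) - 2 = h ^+ 2 + 4 * h.
  rewrite e2 e2' /h.
  transitivity ((expR x + expR (- x)) ^+ 2 - 2 * (expR x * expR (- x)) - 2); first by ring.
  by rewrite xx; ring.
set v := p * (1 - p).
have v0 : 0 <= v by rewrite /v; nra.
have vp : v <= p by rewrite /v; nra.
have vh0 : 0 <= v * h by rewrite mulr_ge0.
(* The linear terms [4 v h] cancel, leaving [v h ^+ 2 + 4 (v h) ^+ 2], which is at most
   [5 p h ^+ 2 <= 80 p x ^+ 4]. *)
have a1 : ln (1 + v * (h ^+ 2 + 4 * h)) <= v * (h ^+ 2 + 4 * h).
  have : 0 <= v * (h ^+ 2 + 4 * h) by have := sqr_ge0 h; move=> hh; apply: mulr_ge0 => //; lra.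
  by move=> w0; apply: le_ln1Dx; lra.
have a2 : v * h - (v * h) ^+ 2 <= ln (1 + v * h).
  apply: le_trans (ln1D_ge _ _); last lra.
  rewrite lerD2l lerN2 ler_pdivrMr; last lra.
  by rewrite ler_peMr ?sqr_ge0//; lra.
have v2 : v ^+ 2 <= p by rewrite /v; nra.
have h2 : h ^+ 2 <= 16 * x ^+ 4.
  have : 0 <= x ^+ 2 by exact: sqr_ge0.
  by rewrite (_ : x ^+ 4 = x ^+ 2 * x ^+ 2); [nra|ring].
have b1 : v * h ^+ 2 <= p * h ^+ 2 by rewrite ler_wpM2r ?sqr_ge0.
have b2 : v ^+ 2 * h ^+ 2 <= p * h ^+ 2 by rewrite ler_wpM2r ?sqr_ge0.
have b3 : p * h ^+ 2 <= p * (16 * x ^+ 4) by rewrite ler_wpM2l// ltW.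
rewrite exprMn in a2; lra.
Qed.

End LogMgfExpansion.

(** * Limits of the couplings and mean-square convergence of the Gibbs sums *)

Section Asymptotics.
Context {R : realType}.
Variables (beta : R) (p : nat -> R).
Hypotheses (beta_gt0 : 0 < beta) (beta_lt1 : beta < 1)
  (p_range : forall N : nat, (0 < N)%N -> 0 < p N <= 1)
  (p3N2 : (fun N : nat => p N ^+ 3 * N%:R ^+ 2) @ \oo --> +oo).

Local Notation g N := (edge_coupling N (p N) beta).

Lemma cvg_inv_p3N2 : (p N ^+ 3 * N%:R ^+ 2)^-1 @[N --> \oo] --> (0 : R).
Proof.
apply/gtr0_cvgV0; last exact: p3N2.
by move/cvgryPgt : p3N2 => /(_ 0).
Qed.

(** As [p <= 1], [p ^+ 3 N ^+ 2 <= (N p) ^+ 2], so the square root of the preceding null sequence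
    dominates. *)
Lemma cvg_inv_Np : (N%:R * p N)^-1 @[N --> \oo] --> (0 : R).
Proof.
have h : Num.sqrt ((p N ^+ 3 * N%:R ^+ 2)^-1) @[N --> \oo] --> (0 : R).
  rewrite -[X in _ --> X](@sqrtr0 R).
  by apply: continuous_cvg; [exact: sqrt_continuous|exact: cvg_inv_p3N2].
apply: (@squeeze_cvgr _ _ _ _ (cst 0) _ _ _ _ _ h); last exact: cvg_cst.
near=> N; have N0 : (0 < N)%N by near: N; exists 1%N.
have /andP[p0 p1] := p_range N N0.
have n0 : 0 < N%:R :> R by rewrite ltr0n.
rewrite invr_ge0 mulr_ge0 ?(ltW p0) ?(ltW n0)//=.
rewrite sqrtrV ?mulr_ge0 ?exprn_ge0 ?(ltW p0) ?(ltW n0)//.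
rewrite lef_pV2 ?posrE ?mulr_gt0 ?sqrtr_gt0 ?mulr_gt0 ?exprn_gt0//.
rewrite -[leRHS]ger0_norm ?mulr_ge0 ?(ltW p0) ?(ltW n0)// -sqrtr_sqr ler_wsqrtr//.
rewrite exprMn mulrC ler_wpM2l ?exprn_ge0 ?(ltW n0)//.
by rewrite exprS ler_piMl ?exprn_ge0 ?(ltW p0).
Unshelve. all: by end_near. Qed.

Lemma edge_couplingE N : (0 < N)%N -> g N = beta / 2 * (N%:R * p N)^-1.
Proof.
move=> N0; have /andP[p0 _] := p_range N N0.
have n0 : N%:R != 0 :> R by rewrite pnatr_eq0 -lt0n.
by rewrite /edge_coupling; field; rewrite n0 lt0r_neq0.
Qed.

Lemma cvg_edge_coupling : g N @[N --> \oo] --> (0 : R).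
Proof.
apply: cvg_trans (_ : beta / 2 * (N%:R * p N)^-1 @[N --> \oo] --> _).
  apply: near_eq_cvg; near=> N; rewrite edge_couplingE//.
  by near: N; exists 1%N.
by rewrite -(mulr0 (beta / 2)); apply: cvgMr; exact: cvg_inv_Np.
Unshelve. all: by end_near. Qed.

(** The bound [1 / 4] puts both [g] and [2 g] into the range [|x| <= 1 / 2] of the expansions. *)
Lemma near_edge_coupling : \forall N \near \oo,
  (0 < N)%N /\ 0 < g N <= 1 / 4.
Proof.
near=> N; have N0 : (0 < N)%N by near: N; exists 1%N.
have /andP[p0 p1] := p_range N N0; split => //.
rewrite edge_couplingE// !mulr_gt0 ?invr_gt0 ?mulr_gt0 ?ltr0n//=.
rewrite -edge_couplingE//; apply/ltW; near: N.
by apply: (cvgr_lt _ cvg_edge_coupling); lra.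
Unshelve. all: by end_near. Qed.

Lemma Np_edge_coupling_sqr N : (0 < N)%N ->
  N%:R * p N * g N ^+ 2 = beta ^+ 2 / 4 * (N%:R * p N)^-1.
Proof.
move=> N0; have /andP[p0 _] := p_range N N0; rewrite edge_couplingE//.
have n0 : N%:R != 0 :> R by rewrite pnatr_eq0 -lt0n.
by field; rewrite n0 lt0r_neq0.
Qed.

Lemma Np_edge_coupling N : (0 < N)%N -> N%:R * p N * g N = beta / 2.
Proof.
move=> N0; have /andP[p0 _] := p_range N N0; rewrite edge_couplingE//.
have n0 : N%:R != 0 :> R by rewrite pnatr_eq0 -lt0n.
by field; rewrite n0 lt0r_neq0.
Qed.

(** The leading term of [er_odd] contributes [2 N p g = beta] whatever [c] is, and the error is of
    order [N p g ^+ 2], that is [1 / (N p)]. The values 1 and 2 of [c] serve the first and the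
    second moment. *)
Lemma cvg_er_odd (c : R) : 0 < c <= 2 ->
  N%:R * (er_odd (p N) (c * g N) / c) @[N --> \oo] --> beta.
Proof.
move=> /andP[c0 c2].
apply/subr_cvg0.
have lim0 : 16 * c * (beta ^+ 2 / 4) * (N%:R * p N)^-1 @[N --> \oo] --> (0 : R).
  by rewrite -(mulr0 (16 * c * (beta ^+ 2 / 4))); apply: cvgMr; exact: cvg_inv_Np.
apply/norm_cvg0P.
apply: (@squeeze_cvgr _ _ _ _ (cst 0) _ _ _ _ _ lim0); last exact: cvg_cst.
near=> N; rewrite normr_ge0/=.
have [N0 /andP[g0 g4]] : (0 < N)%N /\ 0 < g N <= 1 / 4.
  by near: N; exact: near_edge_coupling.
have n0 : 0 < N%:R :> R by rewrite ltr0n.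
have cg : `|c * g N| <= 1 / 2.
  rewrite ger0_norm; last by rewrite mulr_ge0 ?ltW.
  by apply: le_trans (ler_wpM2r (ltW g0) c2) _; lra.
have := er_odd_approx _ _ (p_range N N0) cg.
rewrite -(@ler_pM2l _ (N%:R / c)) ?divr_gt0//.
rewrite -{1}(@gtr0_norm _ (N%:R / c)) ?divr_gt0// -normrM.
have c0' := lt0r_neq0 c0.
have -> : N%:R / c * (er_odd (p N) (c * g N) - 2 * p N * (c * g N)) =
  N%:R * (er_odd (p N) (c * g N) / c) - 2 * (N%:R * p N * g N) by field.
rewrite Np_edge_coupling// (_ : 2 * (beta / 2) = beta); last by field.
move/le_trans; apply.
rewrite -[leRHS]mulrA -Np_edge_coupling_sqr// le_eqVlt; apply/orP; left; apply/eqP.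
by field.
Unshelve. all: by end_near. Qed.

Lemma near_er_even2 : \forall N \near \oo,
  `|N%:R * (er_even (p N) (2 * g N) / 2)| <= 32 * (N%:R * p N)^-1.
Proof.
near=> N.
have [N0 /andP[g0 g4]] : (0 < N)%N /\ 0 < g N <= 1 / 4.
  by near: N; exact: near_edge_coupling.
have n0 : 0 < N%:R :> R by rewrite ltr0n.
have /andP[p0 p1] := p_range N N0.
have cg : `|2 * g N| <= 1 / 2 by rewrite ger0_norm; lra.
have := er_even_approx _ _ (p_range N N0) cg.
rewrite -(@ler_pM2l _ (N%:R / 2)) ?divr_gt0//.
rewrite -{1}(@gtr0_norm _ (N%:R / 2)) ?divr_gt0// -normrM.
rewrite (_ : N%:R / 2 * er_even _ _ = N%:R * (er_even (p N) (2 * g N) / 2)); last by field.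
move/le_trans; apply.
have -> : N%:R / 2 * (16 * p N * (2 * g N) ^+ 2) = 32 * (N%:R * p N * g N ^+ 2) by field.
rewrite ler_wpM2l// Np_edge_coupling_sqr// ler_piMl ?invr_ge0 ?mulr_ge0 ?(ltW n0) ?(ltW p0)//.
have : beta ^+ 2 <= 1 by rewrite exprn_ile1// ltW.
lra.
Unshelve. all: by end_near. Qed.

(** The logarithm of the second-moment prefactor over the squared first-moment one:
    [N ^+ 2 p g ^+ 4] with [g = beta / (2 N p)] is [beta ^+ 4 / (16 p ^+ 3 N ^+ 2)]. *)
Lemma near_er_even_double : \forall N \near \oo,
  N%:R ^+ 2 * (er_even (p N) (2 * g N) / 4 - er_even (p N) (g N)) <=
  2 * (p N ^+ 3 * N%:R ^+ 2)^-1.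
Proof.
near=> N.
have [N0 /andP[g0 g4]] : (0 < N)%N /\ 0 < g N <= 1 / 4.
  by near: N; exact: near_edge_coupling.
have n0 : 0 < N%:R :> R by rewrite ltr0n.
have /andP[p0 p1] := p_range N N0.
have cg : `|g N| <= 1 / 2 by rewrite ger0_norm; lra.
have := er_even_double _ _ (p_range N N0) cg.
rewrite -(@ler_pM2l _ (N%:R ^+ 2 / 4)) ?divr_gt0 ?exprn_gt0//.
have -> : N%:R ^+ 2 / 4 * (er_even (p N) (2 * g N) - 4 * er_even (p N) (g N)) =
  N%:R ^+ 2 * (er_even (p N) (2 * g N) / 4 - er_even (p N) (g N)) by field.
move/le_trans; apply.
have -> : N%:R ^+ 2 / 4 * (80 * p N * g N ^+ 4) =
  20 / 16 * beta ^+ 4 * (p N ^+ 3 * N%:R ^+ 2)^-1.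
  have n0' := lt0r_neq0 n0; have p0' := lt0r_neq0 p0.
  by rewrite edge_couplingE//; field; rewrite n0' p0'.
rewrite ler_wpM2r ?invr_ge0 ?mulr_ge0 ?exprn_ge0 ?(ltW n0) ?(ltW p0)//.
have : beta ^+ 4 <= 1 by rewrite exprn_ile1// ltW.
lra.
Unshelve. all: by end_near. Qed.

(** Expanding the square leaves the second moment, whose upper bound tends to [l ^+ 2], and [- 2 l]
    times the first moment, which tends to [l]. *)
Lemma gibbs_sum_L2_cvg A (t : R) : measurable A ->
  (forall x, x <> t -> {for x, continuous (\1_A : R -> R)}) ->
  let l := cw_const beta * fine (normal_prob 0 (Num.sqrt (1 / (1 - beta))) A) in
  er_mean N (p N) (fun c =>
    (gibbs_sum N (p N) beta A (er_edge N c) / gibbs_scale N (p N) beta - l) ^+ 2)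
  @[N --> \oo] --> (0 : R).
Proof.
move=> mA cA l.
(* With [N * er_even = O(th ^+ 2)], both [th] and the coefficient [b3] of the
   overlap term tend to 0. *)
pose th N : R := Num.sqrt ((N%:R * p N)^-1).
have th0 : th N @[N --> \oo] --> (0 : R).
  rewrite -[X in _ --> X](@sqrtr0 R).
  by apply: continuous_cvg; [exact: sqrt_continuous|exact: cvg_inv_Np].
pose b1 N := N%:R * er_odd (p N) (g N).
pose b2 N := N%:R * (er_odd (p N) (2 * g N) / 2) / (1 - th N).
pose b3 N := N%:R * (er_even (p N) (2 * g N) / 2) / th N.
have b1_cvg : b1 N @[N --> \oo] --> beta.
  have := cvg_er_odd 1; rewrite (_ : b1 = fun N => N%:R * (er_odd (p N) (1 * g N) / 1)).
    by apply; lra.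
  by apply/funext => N; rewrite mul1r divr1.
have b2_cvg : b2 N @[N --> \oo] --> beta.
  suff h : b2 N @[N --> \oo] --> beta / (1 - 0) by rewrite subr0 divr1 in h.
  apply: cvgM; first by apply: cvg_er_odd; lra.
  by apply: cvgV; [rewrite subr0 oner_neq0|apply: cvgB => //; exact: cvg_cst].
have near_th : \forall N \near \oo, 0 < th N < 1.
  near=> N; have N0 : (0 < N)%N by near: N; exists 1%N.
  have /andP[p0 p1] := p_range N N0.
  apply/andP; split; first by rewrite sqrtr_gt0 invr_gt0 mulr_gt0 ?ltr0n.
  by near: N; apply: (cvgr_lt _ th0).
have b3_cvg : b3 N @[N --> \oo] --> (0 : R).
  apply/norm_cvg0P.
  have lim0 : 32 * th N @[N --> \oo] --> (0 : R).
    by rewrite -(mulr0 32); apply: cvgMr.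
  apply: (@squeeze_cvgr _ _ _ _ (cst 0) _ _ _ _ _ lim0); last exact: cvg_cst.
  near=> N; rewrite normr_ge0/=.
  have N0 : (0 < N)%N by near: N; exists 1%N.
  have /andP[p0 p1] := p_range N N0.
  have /andP[t0 t1] : 0 < th N < 1 by near: N.
  rewrite /b3 normrM normfV (gtr0_norm t0) ler_pdivrMr//.
  have -> : 32 * th N * th N = 32 * (N%:R * p N)^-1.
    by rewrite -mulrA -expr2 sqr_sqrtr// invr_ge0 mulr_ge0// ltW.
  by near: N; exact: near_er_even2.
pose r N : R := 2 * (p N ^+ 3 * N%:R ^+ 2)^-1.
have r0 : r N @[N --> \oo] --> (0 : R).
  by rewrite -(mulr0 2); apply: cvgMr; exact: cvg_inv_p3N2.
have up : expR (r N) * ((1 - th N) * cw_avg (b2 N) A N ^+ 2 +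
    th N * cw_avg (b3 N) setT N) + (l ^+ 2 - 2 * l * cw_avg (b1 N) A N)
    @[N --> \oo] --> (0 : R).
  (* The overlap average tends to the finite [cw_const 0], so its weight [th N] makes it vanish. *)
  have -> : 0 = expR 0 * ((1 - 0) * l ^+ 2 + 0 * cw_const 0) + (l ^+ 2 - 2 * l * l) :> R.
    by rewrite expR0; ring.
  apply: cvgD.
    apply: cvgM; first by apply: continuous_cvg => //; exact: continuous_expR.
    apply: cvgD; last by apply: cvgM => //; exact: (cw_avgT_cvg _ _ b3_cvg).
    apply: cvgM; first by apply: cvgB => //; exact: cvg_cst.
    have h := cw_avg_cvg _ _ _ _ b2_cvg beta_lt1 mA cA.
    exact: (cvgM h h).
  apply: cvgB; first exact: cvg_cst.
  by apply: cvgMr; exact: (cw_avg_cvg _ _ _ _ b1_cvg beta_lt1 mA cA).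
apply: (@squeeze_cvgr _ _ _ _ (cst 0) _ _ _ _ _ up); last exact: cvg_cst.
near=> N.
have N0 : (0 < N)%N by near: N; exists 1%N.
have pN := p_range N N0; have /andP[p0 p1] := pN.
have t01 : 0 < th N < 1 by near: N.
have /andP[t0 t1] := t01.
apply/andP; split.
  rewrite /cst -[leLHS](@er_mean_cst _ N (p N) 0); apply: le_er_mean => [|c].
    by rewrite (ltW p0).
  exact: sqr_ge0.
set U := fun c => gibbs_sum N (p N) beta A (er_edge N c) / gibbs_scale N (p N) beta.
have -> : (fun c => (U c - l) ^+ 2) =
   (fun c => U c ^+ 2 + (U c * (- (2 * l)) + l ^+ 2)).
  by apply/funext => c; ring.
rewrite !er_meanD er_meanZ er_mean_cst gibbs_first_moment//.
have h2 := gibbs_second_moment N (p N) beta A (th N) N0 pN t01.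
apply: lerD; last by rewrite -/(b1 N); lra.
apply: le_trans h2 _; rewrite -/(b2 N) -/(b3 N) ler_wpM2r//; last first.
  rewrite ler_expR /r; near: N; exact: near_er_even_double.
have ge0 b B : 0 <= cw_avg b B N.
  rewrite mulr_ge0 ?invr_ge0 ?exprn_ge0//; apply: sumr_ge0 => s _.
  by rewrite mulr_ge0 ?expR_ge0// indicE.
by rewrite addr_ge0// mulr_ge0 ?sqr_ge0 ?ge0//; lra.
Unshelve. all: by end_near. Qed.

End Asymptotics.

(** * The Levy distance *)

Section LevyDistance.
Context {R : realType}.
Implicit Types (mu nu : probability (measurableTypeR R) R) (t x eps q : R).

Definition distr_fun mu t : R := fine (mu `]-oo, t]%classic).

Lemma distr_funE mu t : mu `]-oo, t]%classic = (distr_fun mu t)%:E.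
Proof. by rewrite fineK// fin_num_measure. Qed.

(** The identity as a random variable under [mu], whose [cdf] is the distribution function of
    [mu]. *)
Let idTR : measurableTypeR R -> R := idfun.

HB.instance Definition _ :=
  @isMeasurableFun.Build _ _ _ _ idTR (@measurable_id _ _ setT).

Lemma cdf_idE mu t : cdf (idTR : {RV mu >-> R}) t = mu `]-oo, t]%classic.
Proof. by []. Qed.

Lemma distr_fun_ge0 mu t : 0 <= distr_fun mu t.
Proof. by rewrite fine_ge0. Qed.

Lemma distr_fun_le1 mu t : distr_fun mu t <= 1.
Proof. by rewrite -lee_fin -distr_funE probability_le1. Qed.

Lemma le_distr_fun mu : {homo distr_fun mu : s t / s <= t}.
Proof.
by move=> s t st; rewrite -lee_fin -!distr_funE -!cdf_idE; exact: cdf_nondecreasing.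
Qed.

Lemma distr_fun_cvgy mu : distr_fun mu t @[t --> +oo] --> (1 : R).
Proof. exact: (fine_cvg (cvg_cdfy1 (idTR : {RV mu >-> R}))). Qed.

Lemma distr_fun_cvgNy mu : distr_fun mu t @[t --> -oo] --> (0 : R).
Proof. exact: (fine_cvg (cvg_cdfNy0 (idTR : {RV mu >-> R}))). Qed.

Lemma distr_fun_right mu t : distr_fun mu x @[x --> t^'+] --> distr_fun mu t.
Proof.
have := @cdf_right_continuous _ _ _ _ (idTR : {RV mu >-> R}) t.
by rewrite cdf_idE distr_funE => h; exact: (fine_cvg h).
Qed.

Definition levy_close mu nu eps t : Prop :=
  distr_fun mu (t - eps) - eps <= distr_fun nu t <= distr_fun mu (t + eps) + eps.

Lemma levy_distE mu nu :
  levy_dist mu nu = inf [set eps | 0 < eps /\ forall t, levy_close mu nu eps t].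
Proof.
congr inf; apply/seteqP; split => eps /= [e0 h]; split => // t; have := h t.
  by rewrite !distr_funE -EFinB -EFinD !lee_fin => -[? ?]; apply/andP.
by rewrite !distr_funE -EFinB -EFinD !lee_fin => /andP[].
Qed.

Lemma levy_dist_le mu nu eps : 0 < eps -> (forall t, levy_close mu nu eps t) ->
  levy_dist mu nu <= eps.
Proof.
by move=> e0 h; rewrite levy_distE; apply: ge_inf => //; exists 0 => y [/ltW].
Qed.

(** The grid depends on [nu] only: mesh [eps], from a point where [nu] has at most [eps / 2] to its
    left up to one with at most [eps / 2] to its right. A shift of [t] by [eps] passes a grid point,
    and monotonicity does the rest; in the tails the values near 0 and 1 suffice. *)
Lemma levy_dist_le_grid nu eps : 0 < eps -> exists m (s : nat -> R), forall mu,
  (forall i, (i < m)%N -> `|distr_fun mu (s i) - distr_fun nu (s i)| <= eps / 2) ->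
  levy_dist mu nu <= eps.
Proof.
move=> e0.
have [a a_le] : exists a, distr_fun nu a <= eps / 2.
  have : \forall t \near -oo, distr_fun nu t < eps / 2.
    by apply: (cvgr_lt _ (distr_fun_cvgNy nu)); lra.
  by move=> [M [_ h]]; exists (M - 1); apply/ltW/h; lra.
have [b b_ge] : exists b, 1 - eps / 2 <= distr_fun nu b.
  have : \forall t \near +oo, 1 - eps / 2 < distr_fun nu t.
    by apply: (cvgr_gt _ (distr_fun_cvgy nu)); lra.
  by move=> [M [_ h]]; exists (M + 1); apply/ltW/h; lra.
pose m := (Num.truncn ((b - a) / eps)).+1.
exists m.+2, (fun i => a + i%:R * eps) => mu h.
set s := (fun i : nat => a + i%:R * eps).
have hs i : (i < m.+2)%N ->
    - (eps / 2) <= distr_fun mu (s i) - distr_fun nu (s i) <= eps / 2.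
  by move=> im; rewrite -ler_norml; exact: h.
have s0 : s 0%N = a by rewrite /s mul0r addr0.
have b_sm : b <= s m.
  by rewrite /s -lerBlDl -ler_pdivrMr// ltW// /m truncnS_gt.
apply: levy_dist_le => // t; rewrite /levy_close.
have [ta|at_] := ltP t a.
  have /andP[h1 h2] := hs 0%N isT; rewrite s0 in h1 h2.
  have : distr_fun mu (t - eps) <= distr_fun mu a by apply: le_distr_fun; lra.
  have : distr_fun nu t <= distr_fun nu a by apply: le_distr_fun; lra.
  have := distr_fun_ge0 nu t; have := distr_fun_ge0 mu (t + eps).
  by move=> *; apply/andP; split; lra.
have [tm|mt] := ltP t (s m); last first.
  have /andP[h1 h2] := hs m (leqnSn _).
  have : distr_fun mu (s m) <= distr_fun mu (t + eps) by apply: le_distr_fun; lra.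
  have : distr_fun nu (s m) <= distr_fun nu t by exact: le_distr_fun.
  have : distr_fun nu b <= distr_fun nu (s m) by exact: le_distr_fun.
  have := distr_fun_le1 nu t; have := distr_fun_le1 mu (t - eps).
  by move=> *; apply/andP; split; lra.
pose i := Num.truncn ((t - a) / eps).
have /andP[i1 i2] : i%:R <= (t - a) / eps < i.+1%:R.
  by apply: truncn_itv; rewrite divr_ge0 ?(ltW e0)// subr_ge0.
have im : (i < m)%N.
  rewrite -(ltr_nat R); apply: le_lt_trans i1 _; rewrite ltr_pdivrMr//.
  by move: tm; rewrite /s; lra.
rewrite ler_pdivlMr// in i1; rewrite ltr_pdivrMr// in i2.
have si : s i <= t by rewrite /s; lra.
have siS : t <= s i.+1 by rewrite /s; lra.
have sit : s i.+1 <= t + eps by rewrite /s -natr1; lra.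
have sti : t - eps <= s i by move: i2; rewrite /s -natr1; lra.
have /andP[h1 h2] : - (eps / 2) <= distr_fun mu (s i) - distr_fun nu (s i) <= eps / 2.
  by apply: hs; rewrite ltnS ltnW// ltnW.
have /andP[h3 h4] : - (eps / 2) <= distr_fun mu (s i.+1) - distr_fun nu (s i.+1) <= eps / 2.
  by apply: hs; rewrite ltnS; exact: leqW.
have := le_distr_fun nu _ _ si; have := le_distr_fun nu _ _ siS.
have := le_distr_fun mu _ _ sit; have := le_distr_fun mu _ _ sti.
by move=> *; apply/andP; split; lra.
Qed.

Lemma levy_close_le mu nu q eps t : q <= eps -> levy_close mu nu q t ->
  levy_close mu nu eps t.
Proof.
rewrite /levy_close => qe /andP[h1 h2].
have : distr_fun mu (t - eps) <= distr_fun mu (t - q) by apply: le_distr_fun; lra.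
have : distr_fun mu (t + q) <= distr_fun mu (t + eps) by apply: le_distr_fun; lra.
by move=> *; apply/andP; split; lra.
Qed.

(** A violated inequality at [t] is strict, so by right-continuity of the smaller side and
    monotonicity of the larger it persists just to the right of [t], where there are rationals. *)
Lemma levy_close_rat mu nu q : ~ (forall t, levy_close mu nu q t) ->
  exists r : rat, ~ levy_close mu nu q (ratr r).
Proof.
move=> /existsNP[t] /negP; rewrite negb_and -!ltNge => /orP[lt1|lt2].
  have : \forall x \near t^'+, distr_fun nu x < distr_fun mu (t - q) - q.
    exact: (cvgr_lt _ (distr_fun_right nu t)).
  move=> near1.
  have [x [xt hx]] : exists x, t < x /\ forall y, t < y < x ->
      distr_fun nu y < distr_fun mu (t - q) - q.
    case: near1 => e/= e0 he; exists (t + e); split; first by rewrite ltrDl.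
    move=> y /andP[ty yx]; apply: he => //=.
    by rewrite ltr0_norm; lra.
  have [r] := rat_in_itvoo xt; rewrite in_itv/= => tr.
  exists r; apply/negP; rewrite negb_and -!ltNge; apply/orP; left.
  apply: lt_le_trans (hx _ tr) _.
  rewrite lerD2r; apply: le_distr_fun.
  by case/andP: tr => ? _; lra.
have near1 : \forall x \near (t + q)^'+, distr_fun mu x < distr_fun nu t - q.
  by apply: (cvgr_lt _ (distr_fun_right mu (t + q))); lra.
have [x [xt hx]] : exists x, t + q < x /\ forall y, t + q < y < x ->
    distr_fun mu y < distr_fun nu t - q.
  case: near1 => e/= e0 he; exists (t + q + e); split; first by rewrite ltrDl.
  move=> y /andP[ty yx]; apply: he => //=.
  by rewrite ltr0_norm; lra.
have xt' : t < x - q by lra.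
have [r] := rat_in_itvoo xt'; rewrite in_itv/= => /andP[r1 r2].
exists r; apply/negP; rewrite negb_and -!ltNge; apply/orP; right.
have : distr_fun mu (ratr r + q) < distr_fun nu t - q by apply: hx; lra.
have : distr_fun nu t <= distr_fun nu (ratr r) by apply: le_distr_fun; lra.
lra.
Qed.

(** Admissible values are upward closed, so their infimum exceeds [eps] exactly when some rational
    above [eps] fails. The countable form gives measurability. *)
Lemma levy_dist_gtP mu nu eps : 0 < eps ->
  eps < levy_dist mu nu <->
  exists q r : rat, eps < ratr q /\ ~ levy_close mu nu (ratr q) (ratr r).
Proof.
move=> e0; split.
  move=> /rat_in_itvoo[q]; rewrite in_itv/= => /andP[q1 q2].
  have [r hr] : exists r : rat, ~ levy_close mu nu (ratr q) (ratr r).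
    apply: levy_close_rat => h; have : levy_dist mu nu <= ratr q.
      by apply: levy_dist_le => //; exact: lt_trans q1.
    by rewrite leNgt q2.
  by exists q, r.
move=> [q [r [eq hr]]]; apply: lt_le_trans eq _; rewrite levy_distE.
apply: lb_le_inf.
  (* The value 1 is always admissible, since distribution functions lie between 0 and 1;
     nonemptiness is required to bound [inf] from below. *)
  exists 1; split => // t; rewrite /levy_close.
  have := distr_fun_ge0 mu (t + 1); have := distr_fun_le1 mu (t - 1).
  have := distr_fun_ge0 nu t; have := distr_fun_le1 nu t.
  by move=> *; apply/andP; split; lra.
move=> x [x0 hx]; rewrite leNgt; apply/negP => xq; apply: hr.
exact: (levy_close_le _ _ _ _ _ (ltW xq) (hx _)).
Qed.

(* Needed because a measure is unconstrained on nonmeasurable sets, so that even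
   an event described up to a null set must first be shown measurable. *)
Lemma measurable_levy_dist_gt d (T : measurableType d)
    (mu : T -> probability (measurableTypeR R) R) nu eps : 0 < eps ->
  (forall t, measurable_fun setT (fun w => distr_fun (mu w) t)) ->
  measurable [set w | eps < levy_dist (mu w) nu].
Proof.
move=> e0 mmu.
have -> : [set w | eps < levy_dist (mu w) nu] =
    \bigcup_(q : rat) \bigcup_(r : rat)
      [set w | eps < ratr q /\ ~ levy_close (mu w) nu (ratr q) (ratr r)].
  apply/seteqP; split => w /=.
    by move=> /(levy_dist_gtP _ _ _ e0)[q [r h]]; exists q => //; exists r.
  by move=> [q _ [r _ h]]; apply/(levy_dist_gtP _ _ _ e0); exists q, r.
apply: bigcupT_measurable_rat => q; apply: bigcupT_measurable_rat => r.
have [eq|neq] := pselect (is_true (eps < ratr q)); last first.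
  by rewrite [X in measurable X](_ : _ = set0)//; apply/seteqP; split => w//= [].
rewrite [X in measurable X](_ : _ =
  (fun w => distr_fun (mu w) (ratr r - ratr q)) @^-1` `]distr_fun nu (ratr r) + ratr q, +oo[ `|`
  (fun w => distr_fun (mu w) (ratr r + ratr q)) @^-1` `]-oo, distr_fun nu (ratr r) - ratr q[).
  apply: measurableU; rewrite -[X in measurable X]setTI.
    exact: mmu.
  exact: mmu.
apply/seteqP; split => w /=; rewrite !in_itv/= ?andbT.
  move=> [_ /negP]; rewrite negb_and -!ltNge => /orP[h|h]; [left|right]; lra.
move=> h; split => //; apply/negP; rewrite negb_and -!ltNge; apply/orP.
by case: h => h; [left|right]; lra.
Qed.

End LevyDistance.

(** * Distribution functions of the Gibbs laws *)

Section GibbsLaw.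
Context {R : realType}.
Implicit Types (N : nat) (beta t : R).

Lemma gibbs_sumT N p beta (e : 'I_N -> 'I_N -> R) :
  gibbs_sum N p beta setT e = partition_function beta p e.
Proof. by apply: eq_bigr => s _; rewrite indicT mulr1. Qed.

Lemma distr_fun_gibbs N p beta (e : 'I_N -> 'I_N -> R) t :
  distr_fun (gibbs_law beta p e) t =
  gibbs_sum N p beta `]-oo, t] e / gibbs_sum N p beta setT e.
Proof.
rewrite gibbs_sumT /distr_fun/= /gibbs_law.
under eq_bigr do rewrite diracE -EFinM.
by rewrite sumEFin -EFinM/= div1r mulrC.
Qed.

Lemma measurable_gibbs_sum N p beta (A : set R) d (T : measurableType d)
    (e : T -> 'I_N -> 'I_N -> R) :
  (forall i j, measurable_fun setT (fun w => e w i j)) ->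
  measurable_fun setT (fun w => gibbs_sum N p beta A (e w)).
Proof.
move=> me; apply: measurable_sum => s; apply: measurable_funM => //.
apply: measurableT_comp => //; apply: measurable_funM => //.
apply: measurable_funM => //; apply: measurable_sum => i; apply: measurable_sum => j.
by apply: measurable_funM => //; apply: measurable_funM.
Qed.

Lemma measurable_distr_fun_gibbs N p beta t d (T : measurableType d)
    (e : T -> 'I_N -> 'I_N -> R) :
  (forall i j, measurable_fun setT (fun w => e w i j)) ->
  measurable_fun setT (fun w => distr_fun (gibbs_law beta p (e w)) t).
Proof.
move=> me.
(* Division by the positive partition function is written through [expR] and [ln], so that
   measurability follows by composition. *)
have -> : (fun w => distr_fun (gibbs_law beta p (e w)) t) = (fun w =>
   gibbs_sum N p beta `]-oo, t] (e w) * expR (- ln (gibbs_sum N p beta setT (e w)))).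
  apply/funext => w; rewrite distr_fun_gibbs expRN lnK//.
  by rewrite posrE gibbs_sumT partition_function_gt0.
apply: measurable_funM; first exact: measurable_gibbs_sum.
apply: measurableT_comp => //; apply: measurableT_comp => //.
by apply: measurableT_comp; [exact: measurable_ln|exact: measurable_gibbs_sum].
Qed.

(** The numerator [(u - l) k - l (v - k)] is at most [2 eta k], and [eta <= k / 2] keeps the
    denominator [v] above [k / 2]. *)
Lemma gibbs_ratio_close (u v k l eta : R) : 0 <= l <= k -> 0 < eta <= k / 2 ->
  `|u - l| < eta -> `|v - k| < eta -> `|u / v - l / k| <= 4 * (eta / k).
Proof.
move=> /andP[l0 lk] /andP[e0 ek] ul vk.
have k0 : 0 < k by lra.
have v0 : k / 2 < v by move: vk; rewrite ltr_norml => /andP[]; lra.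
have v0' : 0 < v by lra.
have -> : u / v - l / k = ((u - l) * k - l * (v - k)) / (v * k).
  by field; rewrite !lt0r_neq0.
rewrite normrM normfV (gtr0_norm (mulr_gt0 v0' k0)) ler_pdivrMr ?mulr_gt0//.
apply: le_trans (ler_normB _ _) _; rewrite !normrM (gtr0_norm k0) (ger0_norm l0).
have h1 : `|u - l| * k <= eta * k by rewrite ler_pM2r// ltW.
have h2 : l * `|v - k| <= k * eta by apply: ler_pM => //; exact: ltW.
have -> : 4 * (eta / k) * (v * k) = 4 * eta * v by field; rewrite lt0r_neq0.
have : eta * (k / 2) <= eta * v by rewrite ler_pM2l// ltW.
lra.
Qed.

End GibbsLaw.

(** * From edge variables to edge configurations *)

Section EdgeConfigurations.
Context {R : realType} d (Omega : measurableType d) (P : probability Omega R).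
Variables (N : nat) (p : R) (edge : 'I_N * 'I_N -> {RV P >-> R}).
Hypotheses (p01 : 0 < p <= 1) (edge_indep : mutually_independent edge)
  (edge1 : forall ij, P [set w | edge ij w = 1] = p%:E)
  (edge0 : forall ij, P [set w | edge ij w = 0] = (1 - p)%:E).

Lemma measure_bigsetU_le (I : Type) (r : seq I) (B : I -> set Omega) :
  (forall i, measurable (B i)) ->
  (P (\big[setU/set0]_(i <- r) B i) <= \sum_(i <- r) P (B i))%E.
Proof.
move=> mB; elim: r => [|i r IH]; first by rewrite !big_nil measure0.
rewrite !big_cons; apply: le_trans (leeD2l _ IH).
by apply: measureU2 => //; apply: bigsetU_measurable.
Qed.

Lemma measurable_edge_eq ij (v : R) : measurable [set w | edge ij w = v].
Proof.
by rewrite (_ : [set _ | _] = edge ij @^-1` [set v]).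
Qed.

Definition config_event (c : {ffun 'I_N * 'I_N -> bool}) : set Omega :=
  [set w | forall ij, edge ij w = (c ij)%:R].

Lemma config_eventE c : config_event c =
  \bigcap_(ij in [set` [set: 'I_N * 'I_N]%SET]) (edge ij @^-1` [set (c ij)%:R]).
Proof. by apply/seteqP; split => w/= h ij; [move=> _; exact: h|apply: h; rewrite /= inE]. Qed.

Lemma measurable_config_event c : measurable (config_event c).
Proof.
by rewrite config_eventE; apply: fin_bigcap_measurable.
Qed.

Lemma prob_config_event c : P (config_event c) = (er_weight N p c)%:E.
Proof.
rewrite config_eventE edge_indep; last by move=> ij; exact: measurable_set1.
rewrite /er_weight -prodEFin; apply: eq_big => [ij|ij _]; first by rewrite inE.
rewrite (_ : edge ij @^-1` _ = [set w | edge ij w = (c ij)%:R])//.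
by case: (c ij).
Qed.

Lemma prob_edge_not01 ij : P (~` ([set w | edge ij w = 1] `|` [set w | edge ij w = 0])) = 0%E.
Proof.
have m1 := measurable_edge_eq ij 1; have m0 := measurable_edge_eq ij 0.
rewrite probability_setC; last exact: measurableU.
rewrite measureU//; last first.
  by apply/seteqP; split => w//= [->]; move/eqP; rewrite oner_eq0.
transitivity (1 - (p%:E + (1 - p)%:E))%E.
  by congr (1 - (_ + _))%E; [exact: edge1|exact: edge0].
by have -> : 0%E = (1 - (p + (1 - p)))%:E :> \bar R by congr (_%:E); ring.
Qed.

(** Markov's inequality carried to the finite model: off the null set [V] where some edge variable
    is neither 0 nor 1, every outcome lies in a configuration event, of probability [er_weight]. *)
Lemma prob_le_er_mean (S : set Omega) (F : {ffun 'I_N * 'I_N -> bool} -> R) :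
  measurable S -> (forall c, 0 <= F c) ->
  (forall c w, config_event c w -> S w -> 1 <= F c) ->
  (P S <= (er_mean N p F)%:E)%E.
Proof.
move=> mS F0 F1.
pose bad ij := ~` ([set w | edge ij w = 1] `|` [set w | edge ij w = 0]).
have mbad ij : measurable (bad ij).
  by apply: measurableC; apply: measurableU; exact: measurable_edge_eq.
pose U := \big[setU/set0]_(c : {ffun 'I_N * 'I_N -> bool}) (S `&` config_event c).
pose V := \big[setU/set0]_(ij : 'I_N * 'I_N) bad ij.
have mSc c : measurable (S `&` config_event c).
  by apply: measurableI => //; exact: measurable_config_event.
have mU : measurable U by apply: bigsetU_measurable.
have mV : measurable V by apply: bigsetU_measurable.
have V0 : P V = 0%E.
  apply/eqP; rewrite -measure_le0; apply: le_trans (measure_bigsetU_le _ _ _ mbad) _.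
  by rewrite big1// => ij _; exact: prob_edge_not01.
have SUV : S `<=` U `|` V.
  move=> w Sw; have [Vw|nVw] := pselect (V w); first by right.
  have h01 ij : edge ij w = 1 \/ edge ij w = 0.
    apply: contrapT => h; apply: nVw; rewrite /V -bigcup_seq.
    by exists ij => //=; exact: mem_index_enum.
  left; pose c := [ffun ij => edge ij w == 1].
  rewrite /U -bigcup_seq; exists c => /=; first exact: mem_index_enum.
  split => // ij; rewrite ffunE.
  by case: (h01 ij) => ->; rewrite ?eqxx// eq_sym oner_eq0.
apply: (@le_trans _ _ (P (U `|` V))); first by rewrite le_measure ?inE//; exact: measurableU.
apply: (@le_trans _ _ (P U + P V)%E); first exact: measureU2.
rewrite V0 adde0.
apply: le_trans (measure_bigsetU_le _ _ _ mSc) _.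
rewrite /er_mean -sumEFin; apply: lee_sum => c _.
have w0 : 0 <= er_weight N p c by apply: er_weight_ge0; case/andP: p01 => /ltW -> ->.
have [/eqP SC0|/set0P[w [Sw cw]]] := boolP (S `&` config_event c == set0).
  by rewrite SC0 measure0 lee_fin mulr_ge0.
apply: (@le_trans _ _ (P (config_event c))).
  by apply: measureIr => //; exact: measurable_config_event.
by rewrite prob_config_event lee_fin ler_peMr ?(F1 c w).
Qed.

End EdgeConfigurations.

Theorem theorem1p1 (R : realType) (beta : R) (p : nat -> R)
    (d : nat -> measure_display)
    (Omega : forall N : nat, measurableType (d N))
    (P : forall N : nat, probability (Omega N) R)
    (edge : forall N : nat, 'I_N * 'I_N -> {RV (P N) >-> R})
    (beta_gt0 : 0 < beta) (beta_lt1 : beta < 1)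
    (p_range : forall N : nat, (0 < N)%N -> 0 < p N <= 1)
    (edge_indep : forall N : nat, mutually_independent (edge N))
    (edge1 : forall (N : nat) (ij : 'I_N * 'I_N),
      P N [set w | edge N ij w = 1] = (p N)%:E)
    (edge0 : forall (N : nat) (ij : 'I_N * 'I_N),
      P N [set w | edge N ij w = 0] = (1 - p N)%:E)
    (p3N2 : (fun N : nat => p N ^+ 3 * N%:R ^+ 2) @ \oo --> +oo) :
  forall eps : R, 0 < eps ->
    (fun N : nat => P N [set w : Omega N |
      eps < levy_dist (gibbs_law beta (p N) (fun i j => edge N (i, j) w))
                      (normal_prob 0 (Num.sqrt (1 / (1 - beta))))])
      @ \oo --> 0%E.
Proof.
move=> eps eps0.
set nu := normal_prob 0 (Num.sqrt (1 / (1 - beta))).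
have nuT : fine (nu setT) = 1 by rewrite /nu probability_setT.
have [m [s grid_close]] := levy_dist_le_grid nu eps eps0.
pose k := cw_const beta; have k0 : 0 < k by exact: cw_const_gt0.
(* The first term of the minimum gives [eta <= k / 2], the second [4 * (eta / k) <= eps / 2]. *)
pose eta := k * Num.min (1 / 2) (eps / 8).
have eta0 : 0 < eta by rewrite mulr_gt0// lt_min; apply/andP; split; lra.
have eta_k : eta <= k / 2.
  by rewrite /eta -[k / 2]mulr1 -mulrA ler_pM2l// mulr1 ge_min div1r lexx.
have eta_eps : 4 * (eta / k) <= eps / 2.
  have : eta / k <= eps / 8 by rewrite /eta mulrC mulKf ?lt0r_neq0// ge_min lexx orbT.
  lra.
pose dev A N c := (gibbs_sum N (p N) beta A (er_edge N c) / gibbs_scale N (p N) beta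
  - k * fine (nu A)) ^+ 2.
have dev0 A N c : 0 <= dev A N c by exact: sqr_ge0.
(* Normalized so that [F N c < 1] forces every deviation below [eta], for the partition function and
   all grid points at once. *)
pose F N c := (dev setT N c + \sum_(i < m) dev `]-oo, s i]%classic N c) / eta ^+ 2.
have dev_cvg A (t : R) : measurable A ->
    (forall x, x <> t -> {for x, continuous (\1_A : R -> R)}) ->
    er_mean N (p N) (dev A N) @[N --> \oo] --> (0 : R).
  exact: gibbs_sum_L2_cvg.
have F_cvg : er_mean N (p N) (F N) @[N --> \oo] --> (0 : R).
  have -> : (fun N => er_mean N (p N) (F N)) = (fun N =>
      (er_mean N (p N) (dev setT N) + \sum_(i < m) er_mean N (p N) (dev `]-oo, s i]%classic N))
      / eta ^+ 2).
    by apply/funext => N; rewrite er_meanZ er_meanD er_mean_sum.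
  suff h : (er_mean N (p N) (dev setT N) +
      \sum_(i < m) er_mean N (p N) (dev `]-oo, s i]%classic N)) / eta ^+ 2
      @[N --> \oo] --> (0 + 0) / eta ^+ 2 by rewrite addr0 mul0r in h.
  apply: cvgMl; apply: cvgD.
    by apply: (dev_cvg _ 0) => // x _; exact: indicT_continuous.
  elim: (m) => [|n IH].
    by under eq_fun do rewrite big_ord0; exact: cvg_cst.
  under eq_fun do rewrite big_ord_recr/=.
  suff h : \sum_(i < n) er_mean N (p N) (dev `]-oo, s i]%classic N) +
    er_mean N (p N) (dev `]-oo, s n]%classic N) @[N --> \oo] --> (0 + 0 : R).
    by rewrite addr0 in h.
  apply: cvgD => //.
  by apply: (dev_cvg _ (s n)) => // x; exact: indic_itvNyc_continuous.
apply: (@squeeze_cvge _ _ _ _ (cst 0%E) _ (fun N => (er_mean N (p N) (F N))%:E)).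
- near=> N; rewrite measure_ge0/=.
  have N0 : (0 < N)%N by near: N; exists 1%N.
  apply: (@prob_le_er_mean _ _ _ _ _ _ (edge N)) => //.
  + exact: p_range.
  + apply: measurable_levy_dist_gt => // t.
    by apply: measurable_distr_fun_gibbs => i j; exact: measurable_funPT.
  + by move=> c; apply: divr_ge0; [rewrite addr_ge0 ?sumr_ge0|exact: sqr_ge0].
  move=> c w cw /= far.
  have eE : (fun i j => edge N (i, j) w) = er_edge N c.
    by apply/funext => i; apply/funext => j; rewrite cw.
  rewrite eE in far; rewrite leNgt; apply/negP => F1.
  rewrite ltr_pdivrMr ?exprn_gt0// mul1r in F1.
  have small A : dev A N c < eta ^+ 2 ->
      `|gibbs_sum N (p N) beta A (er_edge N c) / gibbs_scale N (p N) beta -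
        k * fine (nu A)| < eta.
    rewrite /dev -(real_normK (num_real (_ - _))) ltr_pXn2r// nnegrE//.
    exact: ltW.
  have devT : dev setT N c < eta ^+ 2.
    apply: le_lt_trans F1; by rewrite lerDl sumr_ge0.
  have devs (i : 'I_m) : dev `]-oo, s i]%classic N c < eta ^+ 2.
    apply: le_lt_trans F1; rewrite (bigD1 i)//= addrCA lerDl.
    by rewrite addr_ge0// sumr_ge0.
  move: far; rewrite ltNge => /negP; apply; apply: grid_close => i im.
  have g0 := lt0r_neq0 (gibbs_scale_gt0 N (p N) beta).
  have z0 : gibbs_sum N (p N) beta setT (er_edge N c) != 0.
    by apply: lt0r_neq0; rewrite gibbs_sumT partition_function_gt0.
  have k0' := lt0r_neq0 k0.
  have sT := small _ devT; rewrite nuT mulr1 in sT.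
  have f0 := distr_fun_ge0 nu (s i); have f1 := distr_fun_le1 nu (s i).
  have close := gibbs_ratio_close _ _ k _ eta _ _ (small _ (devs (Ordinal im))) sT.
  rewrite distr_fun_gibbs; apply: le_trans eta_eps.
  (* [gibbs_scale] cancels in the ratio, so the distribution function is a quotient of two rescaled
     sums, each close to its limit. *)
  rewrite (_ : _ / _ - _ = gibbs_sum N (p N) beta `]-oo, s i]%classic (er_edge N c) /
    gibbs_scale N (p N) beta / (gibbs_sum N (p N) beta setT (er_edge N c) /
    gibbs_scale N (p N) beta) - k * distr_fun nu (s i) / k); last first.
    by field; rewrite g0 z0 k0'.
  apply: close; last by rewrite eta0.
  by rewrite mulr_ge0 ?(ltW k0)//= ler_piMr// ltW.
- exact: cvg_cst.
- by apply: cvg_EFin; [exact: nearW|exact: F_cvg].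
Unshelve. all: by end_near. Qed.
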